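(* Let $w$ be a piecewise smooth exact solution of $f(w)_x+S(w)=0$ on $\Omega=[0,1]$ with a jump at $x=\alpha\in(0,1)$, and let $v=v_\nu$ approximate $w$ to order $\nu$ (in the sense defined in the context), with its only discontinuity at $x=\beta=\alpha+\overline\alpha$. Assume in addition that $v=w$ at the boundary, i.e. $v(0)-w(0)=v(1)-w(1)=0$. Let $z:\Omega\to\mathbb{R}^d$ be a smooth (at least Lipschitz-continuous) solution of the adjoint equation $$-f'(w)^T z_x+S'(w)^T z=p'(w)\quad\text{in }\Omega ,$$ where $p:\mathbb{R}^d\to\mathbb{R}$ is a sufficiently smooth function. Let $$J(w):=\int_\Omega p(w)\,dx-z_\alpha^T[f(w)],\qquad J(v):=\int_\Omega p(v)\,dx-z_\alpha^T[f(v)],$$ with $z_\alpha:=z(\alpha)$. Then, as $\nu\to0$, $$J(v)-J(w)=\int_\Omega z^T\bigl(f(v)_x+S(v)\bigr)\,dx+\overline\alpha\left(-z^T(\alpha)\Bigl[\tfrac{d}{dx}f(w)\Bigr]-[p(w)]\right)+o(\nu).$$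
   Context: $f,S:\mathbb{R}^d\to\mathbb{R}^d$ are given smooth functions and $\Omega=[0,1]$. Piecewise smooth: $w$ is discontinuous at $x=\alpha$ and sufficiently smooth away from $\alpha$, meaning that the restrictions of $w$ to $[0,\alpha)$ and $(\alpha,1]$ extend smoothly to $[0,\alpha]$ and $[\alpha,1]$. A superscript $\pm$ denotes the one-sided limit from the right ($+$) or left ($-$). Similarly $v$ has exactly one discontinuity, at $x=\beta$, and is smooth away from $\beta$ in the same sense. Put $\overline\alpha:=\beta-\alpha$. Exact solution: $f(w)_x+S(w)=0$ pointwise away from $\alpha$, and the Rankine-Hugoniot condition $f(w(\alpha))^+-f(w(\alpha))^-=0$ holds. Jumps: $[g]:=g^+-g^-$. Jumps of quantities depending on $w$ (such as $[f(w)]$, $[\frac{d}{dx}f(w)]$, $[p(w)]$) are taken at $x=\alpha$; jumps of quantities depending on $v$ (such as $[f(v)]$) are taken at $x=\beta$. The derivative $f(v)_x$ is the classical pointwise derivative away from $\beta$, and $\int_\Omega z^T(f(v)_x+S(v))\,dx$ is the integral of this pointwise defined function. The adjoint equation is understood (almost everywhere) away from $\alpha$. Asymptotics: $f,S,p,w,\alpha,z$ are fixed; $v=v_\nu$, $\beta=\beta_\nu$, $\overline\alpha$, and the maps $\xi_i$ below depend on a small parameter $\nu>0$, and $\mu=\mu(\nu)$ is another parameter tending to zero as $\nu\to0$. The symbols $O(\cdot)$, $o(\cdot)$ refer to $\nu\to0$, with bounds uniform in $x$. Definition ($v$ approximates $w$ to order $\nu$, also: $v$ is sufficiently close to $w$):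 (i) there exist $0<\alpha<1$, $0<\beta<1$ and smooth, invertible functions $\xi_1:[0,\alpha]\to[0,\beta]$ and $\xi_2:[\alpha,1]\to[\beta,1]$ such that $w(x)=v(\xi_1(x))+O(\nu)$ for $x<\alpha$ and $w(x)=v(\xi_2(x))+O(\nu)$ for $x>\alpha$, uniformly in $x$ (where $\alpha$, $\beta$ are the discontinuity locations of $w$, $v$); (ii) $\frac{d}{dx}\xi_1=1+O(\nu)$, $\frac{d}{dx}\xi_2=1+O(\nu)$, $\xi_1(\alpha)=\xi_2(\alpha)=\beta$, and the second derivatives of the $\xi_i$ are bounded; (iii) the residual satisfies $r(v):=f(v)_x+S(v)=O(\mu)$ pointwise except at the discontinuity of $v$. *)

(* Defs.v *)
From HB Require Import structures.
From mathcomp Require Export all_boot all_order all_algebra.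
From mathcomp Require Export all_classical all_reals all_analysis.

Set Implicit Arguments.
Unset Strict Implicit.
Unset Printing Implicit Defensive.

Export Order.TTheory GRing.Theory Num.Theory.
Export numFieldNormedType.Exports.

Open Scope ring_scope.
Open Scope classical_set_scope.

(* Class C^k, meant for finite-dimensional V, where the continuity of all
   directional derivatives amounts to the continuity of the differential. *)
Fixpoint classC (R : realType) (V W : normedModType R) (k : nat)
    (g : V -> W) : Prop :=
  if k is k'.+1 then
    (forall x, differentiable g x) /\ (forall v, classC k' (fun x => 'D_v g x))
  else continuous g.

Definition smooth (R : realType) (V W : normedModType R) (g : V -> W) : Prop :=
  forall k, classC k g.

(* Regularity on a subset A of the line is the existence of an extension to
   the whole line with that regularity. For A = [a, b[ this says in particular
   that g restricted to [a, b[ extends up to b; nothing is said of g at b. *)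
Definition classC_on (R : realType) (W : normedModType R) (k : nat) (A : set R)
    (g : R -> W) : Prop :=
  exists h : R^o -> W, classC k h /\ (forall x, A x -> g x = h x).

Definition smooth_on (R : realType) (W : normedModType R) (A : set R)
    (g : R -> W) : Prop :=
  exists h : R^o -> W, smooth h /\ (forall x, A x -> g x = h x).

(* "Sufficiently smooth" means of class C^2. *)
Definition piecewise_smooth (R : realType) (W : normedModType R) (a : R)
    (u : R -> W) : Prop :=
  [/\ 0 < a < 1,
      ~ {for a, continuous u},
      classC_on 2 `[0, a[ u
    & classC_on 2 `]a, 1] u].

Definition jump (R : realType) (W : normedModType R) (g : R -> W) (a : R) : W :=
  lim (g x @[x --> a^'+]) - lim (g x @[x --> a^'-]).

(* Elements of R^d are row vectors. The library's Jacobian acts on their right: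
   the differential of f at y maps h to h *m 'J f y, so that f'(y)^T u is
   u *m ('J f y)^T. *)
Definition dotp (R : realType) (d : nat) (a b : 'rV[R]_d) : R :=
  \sum_i a 0 i * b 0 i.

Definition gradient (R : realType) (d : nat) (p : 'rV[R]_d -> R)
    (y : 'rV[R]_d) : 'rV[R]_d :=
  \row_i 'D_(delta_mx 0 i) p y.

Definition residual (R : realType) (d : nat) (f S : 'rV[R]_d -> 'rV[R]_d)
    (u : R -> 'rV[R]_d) (x : R) : 'rV[R]_d :=
  (f \o u)^`()%classic x + S (u x).

(* The Rankine-Hugoniot condition is the last clause. *)
Definition exact_solution (R : realType) (d : nat)
    (f S : 'rV[R]_d -> 'rV[R]_d) (a : R) (w : R -> 'rV[R]_d) : Prop :=
  (forall x, 0 < x < 1 -> x != a -> residual f S w x = 0) /\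
  jump (f \o w) a = 0.

(* z is differentiable almost everywhere by Rademacher's theorem. *)
Definition adjoint_solution (R : realType) (d : nat)
    (f S : 'rV[R]_d -> 'rV[R]_d) (p : 'rV[R]_d -> R) (a : R)
    (w z : R -> 'rV[R]_d) : Prop :=
  [lipschitz z x | x in `[0, 1]] /\
  {ae (@lebesgue_measure R), forall x, 0 < x < 1 -> x != a ->
     derivable z x 1 /\
     - (z^`()%classic x *m ('J f (w x))^T) + z x *m ('J S (w x))^T = gradient p (w x)}.

(* g_nu(x) = O(e(nu)) as nu -> 0+, uniformly in x in A_nu. *)
Definition unifO (R : realType) (W : normedModType R) (A : R -> set R)
    (g : R -> R -> W) (e : R -> R) : Prop :=
  exists C : R, \forall nu \near 0^'+,
    forall x, A nu x -> `|g nu x| <= C * `|e nu|.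

(* Derivatives of xi1 nu and xi2 nu are bounded on the open intervals, where
   the two-sided derivative makes sense; by smoothness the bounds then hold for
   the one-sided derivatives at the end points too. The same applies to the
   residual at 0 and 1. *)
Definition approximates (R : realType) (d : nat) (f S : 'rV[R]_d -> 'rV[R]_d)
    (w : R -> 'rV[R]_d) (alpha : R)
    (v : R -> R -> 'rV[R]_d) (beta mu : R -> R) : Prop :=
  exists xi1 xi2 : R -> R -> R,
  [/\ 0 < alpha < 1 /\ (\forall nu \near 0^'+, 0 < beta nu < 1),
      [/\ \forall nu \near 0^'+,
            smooth_on `[0, alpha] (xi1 nu : R -> R^o) /\
            set_bij `[0, alpha] `[0, beta nu] (xi1 nu),
          \forall nu \near 0^'+,
            smooth_on `[alpha, 1] (xi2 nu : R -> R^o) /\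
            set_bij `[alpha, 1] `[beta nu, 1] (xi2 nu),
          unifO (fun=> `[0, alpha[) (fun nu x => w x - v nu (xi1 nu x)) id
        & unifO (fun=> `]alpha, 1]) (fun nu x => w x - v nu (xi2 nu x)) id],
      [/\ unifO (fun=> `]0, alpha[) (fun nu x => (xi1 nu)^`()%classic x - 1 : R^o) id,
          unifO (fun=> `]alpha, 1[) (fun nu x => (xi2 nu)^`()%classic x - 1 : R^o) id,
          \forall nu \near 0^'+, xi1 nu alpha = beta nu /\ xi2 nu alpha = beta nu,
          unifO (fun=> `]0, alpha[) (fun nu x => (xi1 nu)^`(2) x : R^o) (fun=> 1)
        & unifO (fun=> `]alpha, 1[) (fun nu x => (xi2 nu)^`(2) x : R^o) (fun=> 1)]
    & unifO (fun nu => [set x | 0 < x < 1 /\ x != beta nu])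
        (fun nu => residual f S (v nu)) mu].

(* Here a is the discontinuity of u, where the jump is taken, whereas z is
   evaluated at alpha whatever u is. *)
Definition functionalJ (R : realType) (d : nat) (f : 'rV[R]_d -> 'rV[R]_d)
    (p : 'rV[R]_d -> R) (z : R -> 'rV[R]_d) (alpha : R)
    (u : R -> 'rV[R]_d) (a : R) : R :=
  (\int[lebesgue_measure]_(x in `[0, 1]) p (u x))
    - dotp (z alpha) (jump (f \o u) a).

(* Main.v *)
(* Integrating z^T (f(v) - f(w))_x by parts on each side of alpha and beta, the
   boundary terms add up to -z(beta)^T [f(v)], so that J(v) - J(w) - int z^T r(v)
   is the integral of
     p(v) - p(w) - z^T (S(v) - S(w)) + z_x^T (f(v) - f(w))
   plus (z(beta) - z(alpha))^T [f(v)]. Off the interval between alpha and beta,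
   v - w = O(nu) and the adjoint equation cancels the linear part of the
   integrand, which is therefore o(nu). Between alpha and beta, an interval of
   length O(nu), v and w lie on opposite sides of the jump and the integrand is
   -+([p(w)] - z(alpha)^T [S(w)]) + o(1), because [f(w)] = 0; finally
   [S(w)] = -[f(w)_x], and [f(v)] = o(1) since it is close to [f(w)]. *)
Require Import Defs.
From mathcomp Require Import measurable_realfun ring lra.

Set Implicit Arguments.
Unset Strict Implicit.
Unset Printing Implicit Defensive.

(** * The fundamental theorem of calculus for Lipschitz functions *)

(** Two obstacles shape the proof. The adjoint solution is only Lipschitz and satisfies its equation
    almost everywhere, so integration by parts rests on a fundamental theorem of calculus for
    Lipschitz functions and on a measurable bounded derivative [q]; to leave room for difference
    quotients at the end points, [z] is replaced by a Lipschitz extension [Z] to the whole line. The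
    branches of [v] vary with [nu], so no constant of the estimates may depend on their derivatives:
    Taylor expansions and Lipschitz constants are taken from the fixed branches [h1], [h2] of [w],
    and [v] is measured only by its distance to them, at most [K * nu]. Each contribution to the
    remainder is then a factor of order [nu] (a distance, a length or a displacement of [z]) times a
    tolerance [e], which compactness of [h1] and [h2] over [[0, 1]] makes uniform in [x]. *)

Section lipschitz_ftc.
Context {R : realType}.
Notation mu := (@lebesgue_measure R).
Implicit Types (g phi q : R -> R) (a b x M : R).

(** Dominated convergence and upper limits are used along sequences, so the derivative is read along
    the steps [1/(n+1)]. *)
Lemma cvg_growth_rate_harmonic g x (l : R) : is_derive x 1 g l ->
  (n.+1%:R * (g (x + n.+1%:R^-1) - g x)) @[n --> \oo] --> l.
Proof.
case=> dg <-.
have : h^-1 * (g (h + x) - g x) @[h --> 0^'] --> 'D_1 g x.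
  have -> : (fun h => h^-1 * (g (h + x) - g x)) =
            (fun h => h^-1 *: ((g \o shift x) (h *: 1) - g x)).
    by apply/funext => h /=; rewrite [h *: 1]mulr1.
  exact: dg.
move=> /cvgr_dnbhsP /(_ (@harmonic R)) H.
have {}H : (n.+1%:R^-1)^-1 * (g (n.+1%:R^-1 + x) - g x) @[n --> \oo] --> 'D_1 g x.
  apply: H; split=> [n|]; last exact: cvg_harmonic.
  by rewrite /= invr_eq0 pnatr_eq0.
apply: cvg_trans H; apply: near_eq_cvg; near=> n. by rewrite invrK [x + _]addrC.
Unshelve. all: by end_near.
Qed.

Lemma ae_neq a : {ae mu, forall x, x != a}.
Proof.
exists [set a]; split; [exact: measurable_set1|exact: lebesgue_measure_set1|].
by move=> x /= /negP; rewrite negbK => /eqP.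
Qed.

Lemma continuous_integrable g a b : continuous g ->
  mu.-integrable `[a, b] (EFin \o g).
Proof.
move=> cg; apply: continuous_compact_integrable; first exact: segment_compact.
exact/continuous_subspaceT.
Qed.

Lemma integrable_itv_cst a b (k : R) : mu.-integrable `[a, b] (EFin \o cst k).
Proof. by apply: continuous_integrable; exact: cst_continuous. Qed.

Lemma continuous_FTC2_segment g dg a b : a <= b ->
  (forall x, a <= x <= b -> is_derive x 1 g (dg x)) ->
  {within `[a, b], continuous dg} ->
  \int[mu]_(x in `[a, b]) dg x = g b - g a.
Proof.
rewrite le_eqVlt => /predU1P[-> _ _|ab gdg cdg].
  by rewrite set_itv1 Rintegral_set1 subrr.
have cg x : a <= x <= b -> {for x, continuous g}.
  move=> /gdg dx; apply: differentiable_continuous.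
  exact/derivable1_diffP/ex_derive.
rewrite /Rintegral (@continuous_FTC2 _ dg g)//=.
- split=> [x||].
  + by rewrite in_itv/= => /andP[ax xb]; apply: ex_derive; apply: gdg; rewrite !ltW.
  + by apply: cvg_at_right_filter; apply: cg; rewrite lexx ltW.
  + by apply: cvg_at_left_filter; apply: cg; rewrite lexx ltW.
- move=> x; rewrite in_itv/= => /andP[ax xb]; rewrite derive1E.
  by apply: derive_val; apply: gdg; rewrite !ltW.
Qed.

Lemma continuous_growth_rate g (c h : R) : continuous g ->
  continuous (fun x => c * (g (x + h) - g x)).
Proof.
move=> cg x; apply: cvgM; first exact: cvg_cst.
apply: cvgB; last exact: cg.
apply: (@continuous_comp _ _ _ (fun x => x + h) g); last exact: cg.
by apply: cvgD; [exact: cvg_id|exact: cvg_cst].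
Qed.

Lemma continuous_primitive phi a b : continuous phi ->
  exists P : R -> R, forall x, a < x -> x < b -> is_derive x 1 P (phi x).
Proof.
move=> cphi; exists (fun y => \int[mu]_(x in `[a, y]) phi x) => x ax xb.
have [dPx Px] :=
  continuous_FTC1_closed xb (continuous_integrable _ _ cphi) ax (cphi x).
exact: (DeriveDef dPx (etrans (esym (derive1E _ _)) Px)).
Qed.

(* With P a primitive of phi, the integral over [a, b] of the difference quotient
   of phi is the difference of those of P at b and at a; dominated convergence
   then lets the step tend to 0. *)
Lemma lipschitz_FTC2 phi q a b M : a <= b -> continuous phi ->
  (forall x h, a <= x <= b -> 0 < h <= 1 -> `|phi (x + h) - phi x| <= M * h) ->
  measurable_fun `[a, b] q ->
  {ae mu, forall x, a < x < b -> is_derive x 1 phi (q x)} ->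
  \int[mu]_(x in `[a, b]) q x = phi b - phi a.
Proof.
move=> ab cphi lip mq dphi.
(* Steps are at most 1, so [P] is differentiated at points of [[a, b + 1]]; the margins put this
   interval inside the open one where [P] is a primitive. *)
have [P dP] := @continuous_primitive phi (a - 1) (b + 2) cphi.
pose h n : R := n.+1%:R^-1.
have h01 n : 0 < h n <= 1 by rewrite /h invr_gt0 ltr0n/= invf_le1 ?ltr0n// ler1n.
pose D n x := n.+1%:R * (phi (x + h n) - phi x).
have cD n : continuous (D n) by exact: continuous_growth_rate.
have intD n : \int[mu]_(x in `[a, b]) D n x =
    n.+1%:R * (P (b + h n) - P b) - n.+1%:R * (P (a + h n) - P a).
  have /andP[h0 h1] := h01 n.
  pose G x := n.+1%:R * (P (x + h n) - P x).
  apply: (@continuous_FTC2_segment G) => //; last exact/continuous_subspaceT.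
    move=> x /andP[ax xb].
    have dx : is_derive x 1 P (phi x) by apply: dP; lra.
    have dxh : is_derive (x + h n) 1 P (phi (x + h n)) by apply: dP; lra.
    have dsh : is_derive x 1 (fun x => P (x + h n)) (phi (x + h n)).
      have -> : (fun x => P (x + h n)) = P \o shift (h n) by [].
      have := @is_derive1_comp _ P (shift (h n)) x _ 1 dxh (is_derive_shift _ _ _).
      by rewrite mulr1.
    rewrite /D.
    have := is_deriveZ n.+1%:R (is_deriveB dsh dx).
    exact.
have [iq _ lim_int] : [/\ mu.-integrable `[a, b] (EFin \o q),
    [sequence \int[mu]_(x in `[a, b]) `|(D n x)%:E - (q x)%:E|]_n @ \oo --> 0 &
    [sequence \int[mu]_(x in `[a, b]) (D n x)%:E]_n @ \oo -->
      \int[mu]_(x in `[a, b]) (q x)%:E]%E.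
  apply: (@dominated_convergence _ _ _ mu `[a, b]%classic _
     (fun n x => (D n x)%:E) (EFin \o q) (cst M%:E)) => //.
  - move=> n; apply/measurable_EFinP/measurable_funTS.
    exact: continuous_measurable_fun.
  - exact/measurable_EFinP.
  - apply: (@filterS3 _ _ (ae_filter_ringOfSetsType mu) _ _ _ _ _
      dphi (ae_neq a) (ae_neq b)) => x dx xa xb /=.
    rewrite in_itv/= !le_eqVlt [a == x]eq_sym (negbTE xa) (negbTE xb)/= => /dx {}dx.
    apply/fine_cvgP; split; first by near=> n.
    exact: (cvg_growth_rate_harmonic dx).
  - exact: integrable_itv_cst.
  - apply: aeW => x n /=; rewrite in_itv/= => xab; rewrite lee_fin /D normrM.
    rewrite (ger0_norm (ler0n _ _)) -(invrK n.+1%:R).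
    by rewrite ler_pdivrMl ?invr_gt0 ?ltr0n// mulrC lip.
have /fine_cvgP[_ {}lim_int] : ([sequence \int[mu]_(x in `[a, b]) (D n x)%:E]_n
    @ \oo --> (\int[mu]_(x in `[a, b]) q x)%:E)%E.
  by rewrite /Rintegral fineK//; exact: integrable_fin_num.
apply: (cvg_unique _ lim_int) => //.
have -> : fine \o [sequence (\int[mu]_(x in `[a, b]) (D n x)%:E)%E]_n =
    (fun n => n.+1%:R * (P (b + h n) - P b) - n.+1%:R * (P (a + h n) - P a)).
  by apply/funext => n; rewrite -intD.
apply: cvgB; apply: cvg_growth_rate_harmonic; apply: dP; lra.
Unshelve. all: by end_near.
Qed.

End lipschitz_ftc.

(** * Measurable bounded derivatives of Lipschitz functions *)

Section measurable_derivative.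
Context {R : realType}.

Lemma lipschitz_continuous (W : normedModType R) (g : R -> W) (L : R) :
  (forall x y, `|g x - g y| <= L * `|x - y|) -> continuous g.
Proof.
move=> gL x; apply/cvgrPdist_le => e e0.
have L1 : 0 < `|L| + 1 by rewrite ltr_wpDl.
near=> y; rewrite (le_trans (gL _ _))//.
rewrite (@le_trans _ _ ((`|L| + 1) * `|x - y|))//.
  by rewrite ler_wpM2r// (le_trans (ler_norm L))// lerDl.
rewrite mulrC -ler_pdivlMr//; near: y.
by apply: cvgr_dist_le; [exact: cvg_id|rewrite divr_gt0].
Unshelve. all: by end_near. Qed.

Lemma cvg_norm_le (V : normedModType R) (T : Type) (F : set_system T)
    {FF : ProperFilter F} (f : T -> V) (l : V) (M : R) :
  f @ F --> l -> (\forall t \near F, `|f t| <= M) -> `|l| <= M.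
Proof.
move=> /cvg_norm fl fM; rewrite -(cvg_lim _ fl)//.
by apply: limr_le => //; exact: cvgP fl.
Qed.

(* Where g is not differentiable, its derivative is a junk value that need not
   depend measurably on the point; the upper limit of the difference quotients,
   truncated to [-L, L], is a measurable bounded substitute. *)
Lemma lipschitz_measurable_derive (g : R -> R) (L : R) :
  (forall x y, `|g x - g y| <= L * `|x - y|) ->
  exists q : R -> R, [/\ measurable_fun setT q, (forall x, `|q x| <= L) &
    forall x, derivable g x 1 -> q x = 'D_1 g x].
Proof.
move=> gL; have cg := @lipschitz_continuous R^o _ _ gL.
have L0 : 0 <= L.
  by have := gL 1 0; rewrite subr0 normr1 mulr1; exact: le_trans.
pose D n x := n.+1%:R * (g (x + n.+1%:R^-1) - g x).
have DL n x : `|D n x| <= L.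
  rewrite normrM ger0_norm// -ler_pdivlMl ?ltr0n//.
  have := gL (x + n.+1%:R^-1) x.
  by rewrite (addrC x) addrK (ger0_norm (x := _^-1)) ?invr_ge0 // mulrC.
have mD n : measurable_fun setT (D n).
  by apply: continuous_measurable_fun; exact: continuous_growth_rate.
pose s x := limn_sup (D ^~ x).
have ms : measurable_fun setT s.
  apply: measurable_fun_limn_sup => // t _.
    by exists L => _ [n _ <-]; rewrite (le_trans (ler_norm _)).
  by exists (- L) => _ [n _ <-]; have := DL n t; rewrite ler_norml => /andP[].
exists (fun x => Num.max (- L) (Num.min L (s x))); split.
- apply: measurable_maxr; first exact: measurable_cst.
  by apply: measurable_minr; first exact: measurable_cst.
- by move=> x; rewrite ler_norml le_max lexx/= ge_max ge_min lexx/= ge0_cp.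
- move=> x dg.
  have Dx : D ^~ x @ \oo --> 'D_1 g x.
    by apply: cvg_growth_rate_harmonic; exact: derivableP.
  (* Where [g] is derivable, the upper limit is the derivative, which lies in [[-L, L]], so the
     truncation leaves it unchanged. *)
  rewrite /s (cvg_limn_inf_sup Dx).2.
  have : `|'D_1 g x| <= L.
    by apply: (@cvg_norm_le R^o _ _ _ _ _ _ Dx); exact: nearW.
  by rewrite ler_norml => /andP[? ?]; rewrite (min_idPr _)// (max_idPr _).
Unshelve. all: by end_near. Qed.

End measurable_derivative.

(** * Functions of class C^1 *)

Section classC_calculus.
Context {R : realType}.

Lemma continuous_sum (T : topologicalType) (V : normedModType R) (I : Type)
    (r : seq I) (P : pred I) (F : I -> T -> V) :
  (forall i, P i -> continuous (F i)) ->
  continuous (fun x => \sum_(i <- r | P i) F i x).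
Proof.
move=> cF x; elim: r => [|i r IH].
  rewrite (_ : (fun _ => _) = cst 0); first exact: cst_continuous.
  by apply/funext => y; rewrite big_nil.
have [Pi|nPi] := boolP (P i); last first.
  by under eq_fun do rewrite big_cons (negbTE nPi).
rewrite (_ : (fun _ => _) = F i \+ (fun x => \sum_(j <- r | P j) F j x)).
  by apply: cvgD => //; exact: cF.
by apply/funext => y; rewrite big_cons Pi.
Qed.

Lemma classCW (V W : normedModType R) k (g : V -> W) : classC k.+1 g -> classC k g.
Proof.
elim: k g => [|k IH] g /= [dg Dg]; first by move=> x; exact/differentiable_continuous.
by split=> // v; apply: IH; exact: Dg.
Qed.

Lemma classC_continuous (V W : normedModType R) k (g : V -> W) :
  classC k g -> continuous g.
Proof. by elim: k => // k IH /classCW. Qed.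

(** Restriction to the segment from [x] to [x + h] reduces this to one variable. An exact
    intermediate point is special to scalar functions, which is why vector-valued maps are handled
    coordinate by coordinate. *)
Lemma derivable_mean_value (V : normedModType R) (F : V -> R^o) (x h : V) :
  (forall y, derivable F y h) ->
  exists2 s : R, 0 <= s <= 1 & F (x + h) - F x = 'D_h F (x + s *: h).
Proof.
move=> dF; pose G (s : R) : R := F (x + s *: h).
have dG (s : R) : is_derive s 1 G ('D_h F (x + s *: h)).
  have E : (fun t : R => t^-1 *: ((G \o shift s) (t *: 1) - G s)) =
    (fun t : R => t^-1 *: ((F \o shift (x + s *: h)) (t *: h) - F (x + s *: h))).
    apply/funext => t /=; rewrite /G; congr (_ *: (F _ - _)).
    by rewrite [t *: 1]mulr1 scalerDl addrCA.
  by apply: DeriveDef; rewrite /derivable /derive E//; exact: dF.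
have cG : {within `[0, 1], continuous G}.
  apply: continuous_subspaceT => s; apply/differentiable_continuous.
  exact/derivable1_diffP.
have [s] := MVT_segment ler01 (fun s _ => dG s) cG.
rewrite in_itv/= => s01; rewrite subr0 mulr1 /G scale1r scale0r addr0 => E.
by exists s.
Qed.

Lemma continuous_segment_bounded (V : normedModType R) (G : R -> V) (a b : R) :
  continuous G -> exists2 M, 0 <= M & forall x, a <= x <= b -> `|G x| <= M.
Proof.
move=> cG; have [ab|ba] := leP a b; last first.
  exists 0 => // x /andP[ax xb].
  by have := lt_le_trans ba (le_trans ax xb); rewrite ltxx.
have cNG : {within `[a, b], continuous (fun x => `|G x|)}.
  by apply: continuous_subspaceT => x; apply: cvg_norm; exact: cG.
by have [c _ cP] := EVT_max ab cNG; exists `|G c|.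
Qed.

Lemma classC1_mean_value_bound (g : R -> R) (a b : R) : classC 1 (g : R^o -> R^o) ->
  exists2 L, 0 <= L &
    forall x y, a <= x <= b -> a <= y <= b -> `|g x - g y| <= L * `|x - y|.
Proof.
move=> [dg cg].
have dg1 (x : R) : is_derive x 1 g ('D_1 g x).
  by apply: derivableP; apply/derivable1_diffP; exact: dg.
have [M M0 MP] := @continuous_segment_bounded R^o _ a b (cg 1).
exists M => //.
move=> x y; wlog xy : x y / x <= y.
  move=> H xab yab; have [/H|/ltW/H] := leP x y; first exact.
  by rewrite distrC (distrC y); exact.
move=> /andP[ax xb] /andP[ay yb]; rewrite distrC (distrC x).
have cg' : {within `[x, y], continuous g}.
  by apply: continuous_subspaceT => t; apply/differentiable_continuous; exact: dg.
have [c] := MVT_segment xy (fun s _ => dg1 s) cg'.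
rewrite in_itv/= => /andP[xc cy] ->; rewrite normrM ler_wpM2r//.
by rewrite (le_trans (MP _ _))// (le_trans ax xc)/= (le_trans cy).
Qed.

End classC_calculus.

(** * Integrals over intervals *)

Section interval_integrals.
Context {R : realType}.
Notation mu := (@lebesgue_measure R).
Implicit Types (g h : R -> R) (a b c : R).

(** End points are null sets, so [v] and [w] may be traded for their smooth branches on each piece,
    whatever their values at the break points. Integrability is transferred as well, since [g] comes
    without measurability. *)
Lemma eq_oo_Rintegral g h a b : (forall x, a < x < b -> g x = h x) ->
  mu.-integrable `[a, b] (EFin \o h) ->
  mu.-integrable `[a, b] (EFin \o g) /\
  \int[mu]_(x in `[a, b]) g x = \int[mu]_(x in `[a, b]) h x.
Proof.
move=> gh ih.
have ghE : {in `]a, b[%classic, g =1 h}.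
  by move=> x; rewrite inE/= in_itv/=; exact: gh.
have mh : measurable_fun `]a, b[ (EFin \o h).
  apply: measurable_funS (measurable_int _ ih) => //.
  exact: subset_itv_oo_cc.
have mg : measurable_fun `]a, b[ (EFin \o g).
  by apply: eq_measurable_fun mh => x xab /=; rewrite ghE.
split.
  apply/integrableP; split; first exact: emeasurable_fun_itv_cc mg.
  move/integrableP : ih => [_];
  rewrite (@integral_itv_bndoo _ a b _ true false); last first.
    exact: measurableT_comp.
  rewrite (@integral_itv_bndoo _ a b _ true false); last exact: measurableT_comp.
  by congr (_ < _)%E; apply: eq_integral => x xab /=; rewrite ghE.
rewrite /Rintegral (@integral_itv_bndoo _ a b _ true false)//.
rewrite (@integral_itv_bndoo _ a b _ true false)//.
congr fine.
by apply: eq_integral => x xab /=; rewrite ghE.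
Qed.

Lemma Rintegral_glue g a b c : a <= c <= b ->
  mu.-integrable `[a, c] (EFin \o g) -> mu.-integrable `[c, b] (EFin \o g) ->
  mu.-integrable `[a, b] (EFin \o g) /\
  \int[mu]_(x in `[a, b]) g x =
    \int[mu]_(x in `[a, c]) g x + \int[mu]_(x in `[c, b]) g x.
Proof.
move=> /andP[ac cb] iac icb.
have E : `[a, b]%classic = `[a, c]%classic `|` `]c, b]%classic.
  by apply: itv_bndbnd_setU; rewrite bnd_simp.
have D0 : [disjoint `[a, c]%classic & `]c, b]%classic].
  apply/disj_setPS => x /= []; rewrite !in_itv/= => /andP[_ xc] /andP[cx _].
  by move: cx; rewrite ltNge xc.
have icb' : mu.-integrable `]c, b] (EFin \o g).
  by apply: integrableS icb => //; exact: subset_itv_oc_cc.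
have iab : mu.-integrable `[a, b] (EFin \o g).
  have mU : measurable_fun (`[a, c] `|` `]c, b]) (EFin \o g).
    by apply/measurable_funU => //; split;
      [exact: measurable_int iac|exact: measurable_int icb'].
  rewrite E; apply/integrableP; split => //.
  move/integrableP : iac => [mac fac]; move/integrableP : icb' => [mcb fcb].
  rewrite ge0_integral_setU//; first by rewrite lte_add_pinfty.
  exact: measurableT_comp.
split=> //; rewrite E Rintegral_setU// -?E//; congr (_ + _).
by rewrite Rintegral_itv_obnd_cbnd.
Qed.

(** Serves with [k = 0] on the outer pieces, where the integrand is small, and with [k] the constant
    that the integrand approaches between [alpha] and [beta]. The bound is asked almost everywhere
    because the adjoint equation holds only there. *)
Lemma Rintegral_ae_bound g a b (k e : R) : a <= b -> 0 <= e ->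
  mu.-integrable `[a, b] (EFin \o g) ->
  {ae mu, forall x, a < x < b -> `|g x - k| <= e} ->
  `|\int[mu]_(x in `[a, b]) g x - k * (b - a)| <= e * (b - a).
Proof.
move=> ab e0 ig ge.
have mab : fine (mu `[a, b]) = b - a.
  rewrite lebesgue_measure_itv/= lte_fin; move: ab; rewrite le_eqVlt.
  by move=> /predU1P[->|->//]; rewrite ltxx subrr.
have ik c : mu.-integrable `[a, b] (EFin \o cst c) by exact: integrable_itv_cst.
have kE : k * (b - a) = \int[mu]_(x in `[a, b]) k by rewrite Rintegral_cst// mab.
have eE : e * (b - a) = \int[mu]_(x in `[a, b]) e by rewrite Rintegral_cst// mab.
rewrite kE eE -RintegralB//; last exact: (ik k).
have igk : mu.-integrable `[a, b] (EFin \o (fun x => g x - k)).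
  exact: (integrableB _ ig (ik k)).
apply: (le_trans (le_normr_Rintegral _ igk)) => //.
have igk' := integrable_norm igk.
rewrite /Rintegral; apply: fine_le; [exact: integrable_fin_num|
  exact: (integrable_fin_num _ (ik e))|].
apply: ae_ge0_le_integral => //.
- exact: measurable_int igk'.
apply: (@filterS3 _ _ (ae_filter_ringOfSetsType mu) _ _ _ _ _
  ge (ae_neq a) (ae_neq b)) => x gx xa xb /=.
rewrite in_itv/= lee_fin => /andP[ax xb']; apply: gx.
by rewrite !lt_neqAle eq_sym xa xb ax xb'.
Qed.

End interval_integrals.

(** * C^1 maps of row vectors *)

Section row_vectors.
Context {R : realType} {d : nat}.
Local Notation V := 'rV[R]_d.

Lemma normr_coord_le (x : V) i : `|x 0 i| <= `|x|.
Proof.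
rewrite [leRHS]/Num.Def.normr/= mx_normrE.
exact: (le_bigmax _ (fun i => `|x i.1 i.2|) (0, i)).
Qed.

(** Row vectors carry the maximum norm, so coordinatewise bounds combine without loss; [0 <= M]
    covers the case [d = 0]. *)
Lemma normr_le_coord (x : V) (M : R) :
  0 <= M -> (forall i, `|x 0 i| <= M) -> `|x| <= M.
Proof.
move=> M0 xM; rewrite [leLHS]/Num.Def.normr/= mx_normrE.
by apply: bigmax_le => // -[i j] _ /=; rewrite ord1.
Qed.

Lemma classC1_coord (U : normedModType R) (f : U -> V) i :
  classC 1 f -> classC 1 (fun y => f y 0 i : R^o).
Proof.
move=> [df cf]; split=> [y|v].
  apply: (@differentiable_comp _ _ _ _ f (fun x : V => x 0 i : R^o)) => //.
  exact: differentiable_coord.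
have -> : (fun x => 'D_v (fun y => f y 0 i : R^o) x) = (fun x => 'D_v f x 0 i).
  apply/funext => x; rewrite (derive_mx (diff_derivable (df x))) mxE.
  by [].
move=> x; apply: (@continuous_comp _ _ _ ('D_v f) (fun x : V => x 0 i)).
  exact: cf.
exact: coord_continuous.
Qed.

(** [classC] gives continuity of the derivative in each fixed direction. Expanding a direction that
    moves with the point over the basis reduces it to finitely many fixed ones. *)
Lemma derive_rV (W : normedModType R) (F : V -> W) (y h : V) :
  differentiable F y -> 'D_h F y = \sum_j h 0 j *: 'D_(delta_mx 0 j) F y.
Proof.
move=> dF; rewrite deriveE// {1}(row_sum_delta h) linear_sum.
by apply: eq_bigr => j _; rewrite linearZ/= deriveE.
Qed.

Lemma classC1_comp (W : normedModType R) (F : V -> W) (A : R^o -> V) :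
  classC 1 F -> classC 1 A -> classC 1 (F \o A).
Proof.
move=> [dF cF] CA; have [dA cA] := CA; have ctA := classC_continuous CA.
split=> [x|v]; first exact: differentiable_comp.
have -> : (fun x => 'D_v (F \o A) x) =
    (fun x => \sum_j 'D_v A x 0 j *: 'D_(delta_mx 0 j) F (A x)).
  apply/funext => x; rewrite deriveE; last exact: differentiable_comp.
  by rewrite diff_comp//= -deriveE// -deriveE// derive_rV.
apply: continuous_sum => j _ x; apply: (@cvgZ _ _ _ _ _ (fun x => 'D_v A x 0 j : R^o)).
  apply: (@continuous_comp _ _ _ ('D_v A) (fun x : V => x 0 j)); first exact: cA.
  exact: coord_continuous.
apply: (@continuous_comp _ _ _ A ('D_(delta_mx 0 j) F)); first exact: ctA.
exact: cF.
Qed.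

Lemma classC1_lipschitz (A : R -> V) (a b : R) : classC 1 (A : R^o -> V) ->
  exists2 L, 0 <= L &
    forall x y, a <= x <= b -> a <= y <= b -> `|A x - A y| <= L * `|x - y|.
Proof.
move=> CA.
have H i := classC1_mean_value_bound a b (classC1_coord i CA).
pose L i := s2val (cid2 (H i)).
have L0 i : 0 <= L i by exact: (s2valP (cid2 (H i))).
exists (\sum_i L i) => [|x y xab yab]; first exact: sumr_ge0.
apply: normr_le_coord => [|i]; first by rewrite mulr_ge0// sumr_ge0.
rewrite !mxE; apply: (le_trans (s2valP' (cid2 (H i)) _ _ xab yab)).
by rewrite ler_wpM2r// (bigD1 i)//= lerDl sumr_ge0.
Qed.

(** Continuity of [G] is uniform along the compact curve [A], with [y] allowed off the curve.
    Compactness enters as a near-covering property, which yields one radius [dl] for all [x]. *)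
Lemma continuous_near_segment (W : normedModType R) (G : V -> W) (A : R -> V)
    (a b e : R) :
  continuous G -> continuous A -> 0 < e ->
  \forall dl \near 0^'+, forall x y, a <= x <= b -> `|y - A x| < dl ->
    `|G y - G (A x)| <= e.
Proof.
move=> cG cA e0.
have : near_covering (`[a, b]%classic : set R).
  by apply/compact_near_coveringP; exact: segment_compact.
pose P dl x := forall y, `|y - A x| < dl -> `|G y - G (A x)| <= e.
move=> /(_ _ _ P (at_right_proper_filter 0)) NC.
suff /NC : forall x : R, `[a, b]%classic x ->
    \forall x' \near x & dl \near 0^'+, P dl x'.
  by apply: filterS => dl H x y xab; apply: H; rewrite /= in_itv.
move=> x _.
have e20 : 0 < e / 2 by rewrite divr_gt0.
have /cvgrPdist_le /(_ _ e20) := cG (A x).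
move=> /nbhs_ballP[r /= r0 rG].
have rG' y : `|y - A x| < r -> `|G y - G (A x)| <= e / 2.
  by move=> yr; rewrite distrC; apply: rG; rewrite -ball_normE /= distrC.
(* One half is spent on the distance from [y] to [A t], the other on that from [A t] to [A x]. *)
have r20 : 0 < r / 2 by rewrite divr_gt0.
near=> t dl => y yt.
have tr : `|A t - A x| < r / 2.
  rewrite distrC; near: t.
  by have /cvgrPdist_lt /(_ _ r20) := cA x.
have dlr : dl < r / 2 by near: dl; exact: nbhs_right_lt.
rewrite (splitr e) -(subrKA (G (A x))) (le_trans (ler_normD _ _))// lerD//.
  apply: rG'; rewrite -(subrKA (A t)) (le_lt_trans (ler_normD _ _))//.
  by rewrite (splitr r) ltrD// (lt_trans yt).
rewrite distrC; apply: rG'; rewrite (lt_trans tr)//; lra.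
Unshelve. all: by end_near. Qed.

(** By the mean value theorem the remainder is a variation of the partial derivatives between a
    point of the curve and a nearby point, small for all [x] at once by uniform continuity. *)
Lemma taylor1_near_segment (F : V -> R) (A : R -> V) (a b e : R) :
  classC 1 (F : V -> R^o) -> continuous A -> 0 < e ->
  \forall dl \near 0^'+, forall x y, a <= x <= b -> `|y - A x| < dl ->
    `|F y - F (A x) - 'D_(y - A x) (F : V -> R^o) (A x)| <= e * `|y - A x|.
Proof.
move=> [dF cF] cA e0.
(* Each of the [d] partial derivatives gets a share of [e]; the successor avoids division by zero
   when [d = 0]. *)
have e1 : 0 < e / d.+1%:R by rewrite divr_gt0.
have := filter_forall _ (fun j =>
  @continuous_near_segment R^o _ _ a b _ (cF (delta_mx 0 j)) cA e1).
move=> /(_ (at_right_proper_filter 0)); apply: filterS.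
move=> dl H x y xab yx; set h := y - A x.
have [s /andP[s0 s1] E] := @derivable_mean_value _ _ F (A x) h
  (fun y => diff_derivable (dF y)).
have -> : y = A x + h by rewrite addrC subrK.
rewrite E !derive_rV// -sumrB.
apply: (@le_trans _ _ (\sum_(j < d) `|h| * (e / d.+1%:R))).
  apply: (le_trans (ler_norm_sum _ _ _)); apply: ler_sum => j _.
  rewrite -scalerBr normrZ ler_pM//; first exact: normr_coord_le.
  apply: H => //; rewrite addrC addKr normrZ ger0_norm//.
  by rewrite (le_lt_trans _ yx)// ler_piMl.
rewrite sumr_const card_ord -[_ *+ d]mulr_natl mulrCA [leRHS]mulrC ler_wpM2l//.
by rewrite mulrA ler_pdivrMr ?ltr0n// mulrC ler_wpM2l ?(ltW e0)// ler_nat.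
Qed.

End row_vectors.

(** * Vector-valued expansions, the dot product and the linearized adjoint equation *)

Section row_vector_fields.
Context {R : realType} {d : nat}.
Local Notation V := 'rV[R]_d.

Lemma taylor1_near_segment_rV m (F : V -> 'rV[R]_m) (A : R -> V) (a b e : R) :
  classC 1 F -> continuous A -> 0 < e ->
  \forall dl \near 0^'+, forall x y, a <= x <= b -> `|y - A x| < dl ->
    `|F y - F (A x) - 'D_(y - A x) F (A x)| <= e * `|y - A x|.
Proof.
move=> CF cA e0.
have := filter_forall _ (fun i =>
  @taylor1_near_segment _ _ _ _ a b _ (classC1_coord i CF) cA e0).
move=> /(_ (at_right_proper_filter 0)); apply: filterS => dl H x y xab yx.
apply: normr_le_coord => [|i]; first by rewrite mulr_ge0// ltW.
have := H i x y xab yx; rewrite (derive_mx (diff_derivable (CF.1 _))) !mxE.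
by [].
Qed.

Lemma dotpE n (a b : 'rV[R]_n) : dotp a b = (a *m b^T) 0 0.
Proof. by rewrite mxE; apply: eq_bigr => i _; rewrite mxE. Qed.

Lemma dotpDl (a a' b : V) : dotp (a + a') b = dotp a b + dotp a' b.
Proof. by rewrite !dotpE mulmxDl mxE. Qed.

Lemma dotpDr (a b b' : V) : dotp a (b + b') = dotp a b + dotp a b'.
Proof. by rewrite !dotpE linearD/= mulmxDr mxE. Qed.

Lemma dotpNl (a b : V) : dotp (- a) b = - dotp a b.
Proof. by rewrite !dotpE mulNmx mxE. Qed.

Lemma dotpNr (a b : V) : dotp a (- b) = - dotp a b.
Proof. by rewrite !dotpE linearN/= mulmxN mxE. Qed.

Lemma dotpBl (a a' b : V) : dotp (a - a') b = dotp a b - dotp a' b.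
Proof. by rewrite dotpDl dotpNl. Qed.

Lemma dotpBr (a b b' : V) : dotp a (b - b') = dotp a b - dotp a b'.
Proof. by rewrite dotpDr dotpNr. Qed.

Lemma dotp0 (a : V) : dotp a 0 = 0.
Proof. by rewrite dotpE trmx0 mulmx0 mxE. Qed.

Lemma dotp_mulmx_tr m (a : 'rV[R]_m) (M : 'M[R]_(d, m)) (b : V) :
  dotp (a *m M^T) b = dotp a (b *m M).
Proof. by rewrite [RHS]dotpE dotpE -mulmxA -trmx_mul. Qed.

(** The factor [d] is the price of using the maximum norm instead of the Euclidean one. *)
Lemma norm_dotp_le (a b : V) : `|dotp a b| <= d%:R * (`|a| * `|b|).
Proof.
apply: (le_trans (ler_norm_sum _ _ _)).
rewrite mulr_natl -[leRHS]/(_ *+ _) -[X in _ *+ X](card_ord d) -sumr_const.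
by apply: ler_sum => i _; rewrite normrM ler_pM// normr_coord_le.
Qed.

Lemma dotp_gradient (p : V -> R) (y h : V) : differentiable (p : V -> R^o) y ->
  dotp (gradient p y) h = 'D_h (p : V -> R^o) y.
Proof.
by move=> dp; rewrite derive_rV//; apply: eq_bigr => i _; rewrite mxE mulrC.
Qed.

(* The adjoint equation says that the linear part of the error vanishes. *)
Lemma adjoint_linearization (f S : V -> V) (p : V -> R) (z q u y : V) (e M : R) :
  differentiable f u -> differentiable S u -> differentiable (p : V -> R^o) u ->
  - (q *m ('J f u)^T) + z *m ('J S u)^T = gradient p u ->
  `|f y - f u - 'D_(y - u) f u| <= e -> `|S y - S u - 'D_(y - u) S u| <= e ->
  `|p y - p u - 'D_(y - u) (p : V -> R^o) u| <= e ->
  `|z| <= M -> `|q| <= M ->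
  `|p y - p u - dotp z (S y - S u) + dotp q (f y - f u)| <=
    (1 + 2 * (d%:R * M)) * e.
Proof.
have alg (a b c a' b' c' : R) : c - a + b = 0 ->
  c' - a' + b' = c' - c - (a' - a) + (b' - b) by lra.
move=> df dS dp adj fe Se pe zM qM; set h := y - u in fe Se pe.
have e0 : 0 <= e by exact: le_trans pe.
have M0 : 0 <= M by exact: le_trans zM.
have E : 'D_h (p : V -> R^o) u - dotp z ('D_h S u) + dotp q ('D_h f u) = 0.
  have Ef := dotp_mulmx_tr q ('J f u) h; have ES := dotp_mulmx_tr z ('J S u) h.
  rewrite -(deriveEjacobian h df) in Ef; rewrite -(deriveEjacobian h dS) in ES.
  have -> : 'D_h (p : V -> R^o) u = - dotp q ('D_h f u) + dotp z ('D_h S u).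
    rewrite -(dotp_gradient h dp) -adj (dotpDl (- _)) (dotpNl (q *m _)).
    by congr (- _ + _); [exact: Ef|exact: ES].
  by rewrite addrK addNr.
(* Subtracting the linear part, zero by [E], leaves three Taylor remainders, paired with 1, [z] and
   [q]; hence the constant. *)
have -> : p y - p u - dotp z (S y - S u) + dotp q (f y - f u) =
    (p y - p u - 'D_h (p : V -> R^o) u) - dotp z (S y - S u - 'D_h S u)
    + dotp q (f y - f u - 'D_h f u).
  by rewrite (dotpBr z (S y - S u)) (dotpBr q (f y - f u)); exact: alg.
have dM (a b : V) : `|a| <= M -> `|b| <= e -> `|dotp a b| <= d%:R * M * e.
  move=> aM be; rewrite (le_trans (norm_dotp_le _ _))// -mulrA ler_wpM2l//.
  by rewrite ler_pM.
have -> : (1 + 2 * (d%:R * M)) * e = e + d%:R * M * e + d%:R * M * e by ring.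
rewrite (le_trans (ler_normD _ _))//.
rewrite lerD//; last exact: dM.
by rewrite (le_trans (ler_normB _ _))// lerD//; exact: dM.
Qed.

End row_vector_fields.

(** * Product rule and integration by parts along curves *)

Section dotp_curves.
Context {R : realType} {d : nat}.
Local Notation V := 'rV[R]_d.
Notation mu := (@lebesgue_measure R).
Implicit Types (Z G q : R -> V) (a b L M : R).

Lemma continuous_dotp Z G : continuous Z -> continuous G ->
  continuous (fun x => dotp (Z x) (G x)).
Proof.
move=> cZ cG; apply: (@continuous_sum _ R^o) => i _ x.
apply: cvgM.
  by apply: (@continuous_comp _ _ _ Z (fun x : V => x 0 i));
    [exact: cZ|exact: coord_continuous].
by apply: (@continuous_comp _ _ _ G (fun x : V => x 0 i));
  [exact: cG|exact: coord_continuous].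
Qed.

Lemma is_derive_dotp Z G (x : R) (z' g' : V) :
  is_derive x 1 Z z' -> is_derive x 1 G g' ->
  is_derive x 1 (fun t => dotp (Z t) (G t)) (dotp z' (G x) + dotp (Z x) g').
Proof.
have dcoord (H : R -> V) (h' : V) i : is_derive x 1 H h' ->
    is_derive x 1 (fun t => H t 0 i) (h' 0 i).
  move=> [dH <-]; apply: DeriveDef; first exact: (derivable_mxP _ _ _).1.
  by rewrite derive_mx// mxE.
move=> dZ dG.
rewrite (_ : (fun t => _) =
    \sum_i ((fun t => Z t 0 i) * (fun t => G t 0 i))); last first.
  by apply/funext => t; rewrite fct_sumE.
rewrite /dotp -big_split/=; apply: is_derive_sum => i.
have dZi := dcoord _ _ i dZ; have dGi := dcoord _ _ i dG.
by apply: is_derive_eq; rewrite addrC /GRing.scale/= [_ * z' 0 i]mulrC.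
Qed.

Lemma lipschitz_dotp Z G a b LZ LG MZ MG : 0 <= LZ -> 0 <= LG ->
  (forall x y, a <= x <= b -> a <= y <= b -> `|Z x - Z y| <= LZ * `|x - y|) ->
  (forall x y, a <= x <= b -> a <= y <= b -> `|G x - G y| <= LG * `|x - y|) ->
  (forall x, a <= x <= b -> `|Z x| <= MZ) ->
  (forall x, a <= x <= b -> `|G x| <= MG) ->
  forall x y, a <= x <= b -> a <= y <= b ->
    `|dotp (Z x) (G x) - dotp (Z y) (G y)| <=
      d%:R * (LZ * MG + MZ * LG) * `|x - y|.
Proof.
move=> LZ0 LG0 ZL GL ZM GM x y xab yab.
have -> : dotp (Z x) (G x) - dotp (Z y) (G y) =
    dotp (Z x - Z y) (G x) + dotp (Z y) (G x - G y).
  by rewrite dotpBl dotpBr addrA subrK.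
rewrite (le_trans (ler_normD _ _))// -mulrA mulrDl mulrDr lerD//.
  rewrite (le_trans (norm_dotp_le _ _))// ler_wpM2l// mulrAC ler_pM//.
    exact: ZL.
  exact: GM.
rewrite (le_trans (norm_dotp_le _ _))// ler_wpM2l// -mulrA ler_pM//.
  exact: ZM.
exact: GL.
Qed.

Lemma integrable_dotp q G a b L :
  (forall i, measurable_fun setT (fun x => q x 0 i)) ->
  (forall x, `|q x| <= L) -> continuous G ->
  mu.-integrable `[a, b] (EFin \o (fun x => dotp (q x) (G x))).
Proof.
move=> mq qL cG; apply: measurable_bounded_integrable => //.
- by rewrite /= lebesgue_measure_itv/=; case: ifP; rewrite ?ltry.
- apply: measurable_funTS; apply: measurable_sum => i.
  apply: measurable_funM; first exact: mq.
  apply: continuous_measurable_fun => x.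
  by apply: (@continuous_comp _ _ _ G (fun x : V => x 0 i));
    [exact: cG|exact: coord_continuous].
- have [M M0 GM] := continuous_segment_bounded a b cG.
  exists (d%:R * (L * M)); split; first exact: num_real.
  move=> N MN x; rewrite /= in_itv/= => xab.
  rewrite (le_trans _ (ltW MN))// (le_trans (norm_dotp_le _ _))// ler_wpM2l//.
  by rewrite ler_pM// GM.
Qed.

(** With [Z] merely Lipschitz, the product is Lipschitz and obeys the Leibniz rule almost
    everywhere, which is what [lipschitz_FTC2] integrates. *)
Lemma dotp_integration_by_parts Z G q a b L : a <= b ->
  (forall x y, `|Z x - Z y| <= L * `|x - y|) -> classC 1 (G : R^o -> V) ->
  (forall i, measurable_fun setT (fun x => q x 0 i)) -> (forall x, `|q x| <= L) ->
  {ae mu, forall x, a < x < b -> is_derive x 1 Z (q x)} ->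
  \int[mu]_(x in `[a, b]) (dotp (q x) (G x) + dotp (Z x) ('D_1 (G : R^o -> V) x)) =
    dotp (Z b) (G b) - dotp (Z a) (G a).
Proof.
move=> ab ZL CG mq qL dZ.
have L0 : 0 <= L by rewrite (le_trans _ (qL 0)).
have cZ := lipschitz_continuous ZL.
have cG := classC_continuous CG.
(* The interval is lengthened by 1 because [lipschitz_FTC2] compares values at [x] and [x + h] with
   [h] up to 1. *)
have [MZ MZ0 ZM] := continuous_segment_bounded a (b + 1) cZ.
have [MG MG0 GM] := continuous_segment_bounded a (b + 1) cG.
have [LG LG0 GL] := classC1_lipschitz a (b + 1) CG.
have lipZG := lipschitz_dotp L0 LG0 (fun x y _ _ => ZL x y) GL ZM GM.
apply: (@lipschitz_FTC2 _ (fun x => dotp (Z x) (G x)) _ a b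
  (d%:R * (L * MG + MZ * LG)) ab).
- exact: continuous_dotp.
- move=> x h /andP[ax xb] /andP[h0 h1].
  have xab : a <= x <= b + 1 by rewrite ax ler_wpDr.
  have xhab : a <= x + h <= b + 1 by rewrite lerD// andbT ler_wpDr// ltW.
  have := lipZG _ _ xhab xab.
  have -> : x + h - x = h by rewrite addrC addKr.
  by rewrite (gtr0_norm h0); exact.
- apply: measurable_funD.
    by case/integrableP : (integrable_dotp a b mq qL cG) => /measurable_EFinP.
  apply: measurable_funTS; apply: continuous_measurable_fun.
  by apply: continuous_dotp => //; exact: CG.2.
- apply: (@filterS _ _ (ae_filter_ringOfSetsType mu) _ _ _ dZ) => x dZx xab.
  apply: is_derive_dotp; first exact: dZx.
  apply: derivableP; apply/derivable1_diffP; exact: CG.1.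
Qed.

End dotp_curves.

(** * The error identity *)

Section adjoint_identity.
Context {R : realType} {d : nat}.
Local Notation V := 'rV[R]_d.
Notation mu := (@lebesgue_measure R).
Variables (f S : V -> V) (p : V -> R).
Hypotheses (Cf : classC 1 f) (CS : classC 1 S) (Cp : classC 1 (p : V -> R^o)).

(* q stands for the derivative of z, u for the value of w and y for that of v. *)
Definition adjoint_defect (z q u y : V) : R :=
  p y - p u - dotp z (S y - S u) + dotp q (f y - f u).

Lemma residualE (A : R -> V) (x : R) :
  residual f S A x = 'D_1 (f \o A : R^o -> V) x + S (A x).
Proof. by rewrite /residual derive1E. Qed.

Lemma continuous_residual (A : R -> V) : classC 1 (A : R^o -> V) ->
  continuous (residual f S A).
Proof.
move=> CA.
have -> : residual f S A = 'D_1 (f \o A : R^o -> V) \+ (S \o A).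
  by apply/funext => x; rewrite residualE.
move=> x; apply: cvgD; first exact: (classC1_comp Cf CA).2.
exact: (classC_continuous (classC1_comp CS CA)).
Qed.

Variables (Z q : R -> V) (L : R).
Hypotheses (ZL : forall x y, `|Z x - Z y| <= L * `|x - y|)
  (mq : forall i, measurable_fun setT (fun x => q x 0 i))
  (qL : forall x, `|q x| <= L).

Lemma adjoint_identity (A B : R -> V) (a b : R) : a <= b ->
  classC 1 (A : R^o -> V) -> classC 1 (B : R^o -> V) ->
  {ae mu, forall x, a < x < b -> is_derive x 1 Z (q x)} ->
  (forall x, a < x < b -> residual f S B x = 0) ->
  mu.-integrable `[a, b]
    (EFin \o (fun x => adjoint_defect (Z x) (q x) (B x) (A x))) /\
  \int[mu]_(x in `[a, b]) p (A x) - \int[mu]_(x in `[a, b]) p (B x)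
    - \int[mu]_(x in `[a, b]) dotp (Z x) (residual f S A x) =
  \int[mu]_(x in `[a, b]) adjoint_defect (Z x) (q x) (B x) (A x)
    + dotp (Z a) (f (A a) - f (B a)) - dotp (Z b) (f (A b) - f (B b)).
Proof.
have alg (P s s' D Q : R) : P - (s - s') + Q = P - (D + s) + (Q + (D + s')).
  by ring.
move=> ab CA CB dZ rB0.
have cZ := lipschitz_continuous ZL.
have CfA := classC1_comp Cf CA; have CfB := classC1_comp Cf CB.
pose G x := f (A x) - f (B x).
have dG x : 'D_1 (G : R^o -> V) x =
    'D_1 (f \o A : R^o -> V) x - 'D_1 (f \o B : R^o -> V) x.
  by rewrite -deriveB//; apply/derivable1_diffP; [exact: CfA.1|exact: CfB.1].
have CG : classC 1 (G : R^o -> V).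
  split=> [x|v]; first by apply: differentiableB; [exact: CfA.1|exact: CfB.1].
  have -> : (fun x => 'D_v (G : R^o -> V) x) =
      'D_v (f \o A : R^o -> V) \- 'D_v (f \o B : R^o -> V).
    apply/funext => x /=; rewrite -deriveB//; apply: diff_derivable.
      exact: CfA.1.
    exact: CfB.1.
  by move=> x; apply: cvgB; [exact: CfA.2|exact: CfB.2].
have cpA := classC_continuous (classC1_comp Cp CA).
have cpB := classC_continuous (classC1_comp Cp CB).
have cZr : continuous (fun x => dotp (Z x) (residual f S A x)).
  by apply: continuous_dotp => //; exact: continuous_residual.
(* Since the residual of [B] vanishes, [S (B x)] is minus the derivative of [f \o B]. This splits
   the defect into [k], the integrand of the left-hand side, and [l], the almost everywhere
   derivative of [dotp (Z x) (G x)]. *)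
pose k x := p (A x) - p (B x) - dotp (Z x) (residual f S A x).
pose l x := dotp (q x) (G x) + dotp (Z x) ('D_1 (G : R^o -> V) x).
have ipA := continuous_integrable a b cpA.
have ipB := continuous_integrable a b cpB.
have iZr := continuous_integrable a b cZr.
have iAB : mu.-integrable `[a, b] (EFin \o (fun x => p (A x) - p (B x))).
  exact: (integrableB _ ipA ipB).
have ik : mu.-integrable `[a, b] (EFin \o k).
  exact: (integrableB _ iAB iZr).
have iqG := integrable_dotp a b mq qL (classC_continuous CG).
have cZG : continuous (fun x => dotp (Z x) ('D_1 (G : R^o -> V) x)).
  by apply: continuous_dotp => //; exact: CG.2.
have il : mu.-integrable `[a, b] (EFin \o l).
  exact: (integrableD _ iqG (continuous_integrable a b cZG)).
have ikl : mu.-integrable `[a, b] (EFin \o (fun x => k x + l x)).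
  exact: (integrableD _ ik il).
have ekl x : a < x < b ->
    adjoint_defect (Z x) (q x) (B x) (A x) = k x + l x.
  move=> xab; have := rB0 x xab; rewrite /k /l dG !residualE /G => /eqP.
  rewrite addr_eq0 => /eqP ->; rewrite /adjoint_defect opprK.
  by rewrite (dotpBr _ (S (A x))) !(dotpDr (Z x)); exact: alg.
have [ie ->] := eq_oo_Rintegral ekl ikl; split=> //.
rewrite RintegralD// (dotp_integration_by_parts ab ZL CG mq qL dZ).
rewrite /k (RintegralB _ iAB iZr)// (RintegralB _ ipA ipB)//.
by rewrite addrA subrK addrK.
Qed.

End adjoint_identity.

(** * Jumps, residuals and integrals read off smooth branches *)

Section jumps_and_pieces.
Context {R : realType}.
Notation mu := (@lebesgue_measure R).

Lemma jumpE (W : normedModType R) (g g1 g2 : R -> W) (l c r : R) :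
  l < c < r -> {for c, continuous g1} -> {for c, continuous g2} ->
  (forall x, l < x < c -> g x = g1 x) -> (forall x, c < x < r -> g x = g2 x) ->
  jump g c = g2 c - g1 c.
Proof.
move=> /andP[lc cr] cg1 cg2 gg1 gg2; rewrite /jump; congr (_ - _).
  apply: cvg_lim => //; apply: cvg_trans (cvg_at_right_filter cg2).
  apply: near_eq_cvg; near=> x; rewrite gg2//; apply/andP; split.
    by near: x; exact: nbhs_right_gt.
  by near: x; exact: nbhs_right_lt.
apply: cvg_lim => //; apply: cvg_trans (cvg_at_left_filter cg1).
apply: near_eq_cvg; near=> x; rewrite gg1//; apply/andP; split.
  by near: x; exact: nbhs_left_gt.
by near: x; exact: nbhs_left_lt.
Unshelve. all: by end_near. Qed.

Lemma near_oo (a b x : R) : a < x < b -> \forall y \near x, a < y < b.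
Proof.
move=> xab; have /near_in_itvoo : x \in `]a, b[%R by rewrite in_itv.
by apply: filterS => y; rewrite in_itv.
Qed.

Lemma eq_oo_derive1 (W : normedModType R) (g h : R -> W) (a b x : R) :
  (forall x, a < x < b -> g x = h x) -> a < x < b -> g^`() x = h^`() x.
Proof.
move=> gh xab; rewrite !derive1E; apply: near_eq_derive.
by apply: filterS (near_oo xab) => y; exact: gh.
Qed.

Lemma eq_oo_residual (d : nat) (f S : 'rV[R]_d -> 'rV[R]_d) (u v : R -> 'rV[R]_d)
    (a b x : R) :
  (forall x, a < x < b -> u x = v x) -> a < x < b ->
  residual f S u x = residual f S v x.
Proof.
move=> uv xab; have fuv y : a < y < b -> (f \o u) y = (f \o v) y.
  by move=> /uv/= ->.
by rewrite /residual (uv _ xab) (eq_oo_derive1 fuv xab).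
Qed.

Lemma Rintegral_split3 (g g1 g2 g3 : R -> R) (a m n b : R) :
  a <= m -> m <= n -> n <= b ->
  (forall x, a < x < m -> g x = g1 x) -> (forall x, m < x < n -> g x = g2 x) ->
  (forall x, n < x < b -> g x = g3 x) ->
  continuous g1 -> continuous g2 -> continuous g3 ->
  \int[mu]_(x in `[a, b]) g x = \int[mu]_(x in `[a, m]) g1 x
    + \int[mu]_(x in `[m, n]) g2 x + \int[mu]_(x in `[n, b]) g3 x.
Proof.
move=> am mn nb gg1 gg2 gg3 c1 c2 c3.
have [i1 <-] := eq_oo_Rintegral gg1 (continuous_integrable a m c1).
have [i2 <-] := eq_oo_Rintegral gg2 (continuous_integrable m n c2).
have [i3 <-] := eq_oo_Rintegral gg3 (continuous_integrable n b c3).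
have amn : a <= m <= n by rewrite am.
have anb : a <= n <= b by rewrite (le_trans am).
have [i12 <-] := Rintegral_glue amn i1 i2.
by have [_ <-] := Rintegral_glue anb i12 i3.
Qed.

End jumps_and_pieces.

(** * The error identity across the two discontinuities *)

Section error_identity.
Context {R : realType} {d : nat}.
Local Notation V := 'rV[R]_d.
Notation mu := (@lebesgue_measure R).
Variables (f S : V -> V) (p : V -> R).
Hypotheses (Cf : classC 1 f) (CS : classC 1 S) (Cp : classC 1 (p : V -> R^o)).
Variables (Z q : R -> V) (L : R).
Hypotheses (ZL : forall x y, `|Z x - Z y| <= L * `|x - y|)
  (mq : forall i, measurable_fun setT (fun x => q x 0 i))
  (qL : forall x, `|q x| <= L)
  (dZ : {ae mu, forall x : R, 0 < x < 1 -> is_derive x 1 Z (q x)}).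
Local Notation defect A B x := (adjoint_defect f S p (Z x) (q x) (B x) (A x)).

(* Three pieces, so as to cover both orders of alpha and beta: at m and at n, one
   of v and w jumps while the other one stays on the same branch. *)
Lemma adjoint_identity3 (v w A1 A2 A3 B1 B2 B3 : R -> V) (m n : R) :
  0 <= m -> m <= n -> n <= 1 ->
  classC 1 (A1 : R^o -> V) -> classC 1 (A2 : R^o -> V) -> classC 1 (A3 : R^o -> V) ->
  classC 1 (B1 : R^o -> V) -> classC 1 (B2 : R^o -> V) -> classC 1 (B3 : R^o -> V) ->
  (forall x, 0 < x < m -> v x = A1 x /\ w x = B1 x /\ residual f S B1 x = 0) ->
  (forall x, m < x < n -> v x = A2 x /\ w x = B2 x /\ residual f S B2 x = 0) ->
  (forall x, n < x < 1 -> v x = A3 x /\ w x = B3 x /\ residual f S B3 x = 0) ->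
  A1 0 = B1 0 -> A3 1 = B3 1 ->
  [/\ mu.-integrable `[0, m] (EFin \o (fun x => defect A1 B1 x)),
      mu.-integrable `[m, n] (EFin \o (fun x => defect A2 B2 x)),
      mu.-integrable `[n, 1] (EFin \o (fun x => defect A3 B3 x)) &
  \int[mu]_(x in `[0, 1]) p (v x) - \int[mu]_(x in `[0, 1]) p (w x)
    - \int[mu]_(x in `[0, 1]) dotp (Z x) (residual f S v x) =
  \int[mu]_(x in `[0, m]) defect A1 B1 x + \int[mu]_(x in `[m, n]) defect A2 B2 x
    + \int[mu]_(x in `[n, 1]) defect A3 B3 x
    + (dotp (Z m) (f (A2 m) - f (A1 m)) + dotp (Z m) (f (B1 m) - f (B2 m)))
    + (dotp (Z n) (f (A3 n) - f (A2 n)) + dotp (Z n) (f (B2 n) - f (B3 n)))].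
Proof.
have alg (v1 v2 v3 w1 w2 w3 r1 r2 r3 e1 e2 e3 a1 a2 a3 b2 : R) :
  v1 - w1 - r1 = e1 + 0 - a1 -> v2 - w2 - r2 = e2 + a2 - b2 ->
  v3 - w3 - r3 = e3 + a3 - 0 ->
  v1 + v2 + v3 - (w1 + w2 + w3) - (r1 + r2 + r3) =
  e1 + e2 + e3 + (a2 - a1) + (a3 - b2) by lra.
move=> m0 mn n1 CA1 CA2 CA3 CB1 CB2 CB3 H1 H2 H3 AB0 AB1.
have cZ := lipschitz_continuous ZL.
have cp (A : R -> V) : classC 1 (A : R^o -> V) -> continuous (p \o A).
  by move=> CA; exact: (classC_continuous (classC1_comp Cp CA)).
have cr (A : R -> V) : classC 1 (A : R^o -> V) ->
    continuous (fun x => dotp (Z x) (residual f S A x)).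
  by move=> CA; apply: continuous_dotp => //; exact: continuous_residual.
have dZ' a b : 0 <= a -> b <= 1 ->
    {ae mu, forall x : R, a < x < b -> is_derive x 1 Z (q x)}.
  move=> a0 b1; apply: (@filterS _ _ (ae_filter_ringOfSetsType mu) _ _ _ dZ).
  by move=> x H /andP[ax xb]; apply: H; rewrite (le_lt_trans a0 ax) (lt_le_trans xb b1).
have res a b (A : R -> V) : (forall x, a < x < b -> v x = A x) ->
    forall x, a < x < b ->
    dotp (Z x) (residual f S v x) = dotp (Z x) (residual f S A x).
  by move=> vA x xab; rewrite (eq_oo_residual _ _ vA xab).
have [i1 E1] := adjoint_identity Cf CS Cp ZL mq qL m0 CA1 CB1
  (dZ' 0 m (lexx 0) (le_trans mn n1)) (fun x h => (H1 x h).2.2).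
have [i2 E2] := adjoint_identity Cf CS Cp ZL mq qL mn CA2 CB2
  (dZ' m n m0 n1) (fun x h => (H2 x h).2.2).
have [i3 E3] := adjoint_identity Cf CS Cp ZL mq qL n1 CA3 CB3
  (dZ' n 1 (le_trans m0 mn) (lexx 1)) (fun x h => (H3 x h).2.2).
split=> //.
(* The agreement of [v] and [w] at 0 and 1 removes the outer boundary terms. *)
rewrite AB0 subrr dotp0 in E1; rewrite AB1 subrr dotp0 in E3.
have pv a b (A B : R -> V) :
    (forall x, a < x < b -> v x = A x /\ w x = B x /\ residual f S B x = 0) ->
    (forall x, a < x < b -> p (v x) = (p \o A) x) *
    (forall x, a < x < b -> p (w x) = (p \o B) x) *
    (forall x, a < x < b -> v x = A x).
  by move=> H; split; [split|] => x /H[vE [wE _]]; rewrite /= ?vE ?wE.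
rewrite (Rintegral_split3 m0 mn n1 (pv _ _ _ _ H1).1.1 (pv _ _ _ _ H2).1.1
  (pv _ _ _ _ H3).1.1 (cp _ CA1) (cp _ CA2) (cp _ CA3)).
rewrite (Rintegral_split3 m0 mn n1 (pv _ _ _ _ H1).1.2 (pv _ _ _ _ H2).1.2
  (pv _ _ _ _ H3).1.2 (cp _ CB1) (cp _ CB2) (cp _ CB3)).
rewrite (Rintegral_split3 m0 mn n1 (res _ _ _ (pv _ _ _ _ H1).2)
  (res _ _ _ (pv _ _ _ _ H2).2) (res _ _ _ (pv _ _ _ _ H3).2)
  (cr _ CA1) (cr _ CA2) (cr _ CA3)).
(* Boundary terms compare [v] with [w] on one side of a break point; regrouped, they compare the two
   sides for [v] and for [w] separately, that is, they become jumps. *)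
have reg (x : R) (a b c e : V) :
    dotp (Z x) (a - b) + dotp (Z x) (c - e) =
    dotp (Z x) (a - e) - dotp (Z x) (b - c).
  rewrite -dotpDr -dotpBr; congr dotp.
  by rewrite opprB addrACA [RHS]addrACA [- e - b]addrC.
rewrite !reg.
exact: alg E1 E2 E3.
Qed.

End error_identity.

(** * From pointwise bounds on the defect to a bound on the error *)

Section error_bound.
Context {R : realType} {d : nat}.
Local Notation V := 'rV[R]_d.
Notation mu := (@lebesgue_measure R).
Variables (f S : V -> V) (p : V -> R).
Hypotheses (Cf : classC 1 f) (CS : classC 1 S) (Cp : classC 1 (p : V -> R^o)).
Variables (Z q : R -> V) (L : R).
Hypotheses (ZL : forall x y, `|Z x - Z y| <= L * `|x - y|)
  (mq : forall i, measurable_fun setT (fun x => q x 0 i))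
  (qL : forall x, `|q x| <= L)
  (dZ : {ae mu, forall x : R, 0 < x < 1 -> is_derive x 1 Z (q x)}).
Local Notation defect A B x := (adjoint_defect f S p (Z x) (q x) (B x) (A x)).

(** The outer pieces have length at most 1, so [eta] is meant to be [o(nu)]; between [alpha] and
    [beta] the length is itself a factor, and an error [e] tending to 0 suffices. The defect
    approaches [c] there if [alpha < beta], and [- c] on a length [alpha - beta] otherwise, so
    [(beta - alpha) * c] covers both orders. The last term pays for evaluating [Z] at [alpha]
    instead of [beta]. *)
Lemma adjoint_error_bound (v w a b h1 h2 : R -> V) (alpha beta eta e : R) :
  0 < alpha < 1 -> 0 < beta < 1 ->
  classC 1 (a : R^o -> V) -> classC 1 (b : R^o -> V) ->
  classC 1 (h1 : R^o -> V) -> classC 1 (h2 : R^o -> V) ->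
  (forall x, 0 < x < beta -> v x = a x) -> (forall x, beta < x < 1 -> v x = b x) ->
  (forall x, 0 < x < alpha -> w x = h1 x) -> (forall x, alpha < x < 1 -> w x = h2 x) ->
  (forall x, 0 < x < alpha -> residual f S h1 x = 0) ->
  (forall x, alpha < x < 1 -> residual f S h2 x = 0) ->
  f (h1 alpha) = f (h2 alpha) -> a 0 = h1 0 -> b 1 = h2 1 -> 0 <= eta -> 0 <= e ->
  let c := p (h1 alpha) - p (h2 alpha)
    - dotp (Z alpha) (S (h1 alpha) - S (h2 alpha)) in
  let jf := f (b beta) - f (a beta) in
  {ae mu, forall x : R, 0 < x < alpha -> x < beta -> `|defect a h1 x| <= eta} ->
  {ae mu, forall x : R, alpha < x < 1 -> beta < x -> `|defect b h2 x| <= eta} ->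
  (forall x, alpha < x < beta -> `|defect a h2 x - c| <= e) ->
  (forall x, beta < x < alpha -> `|defect b h1 x + c| <= e) ->
  `|\int[mu]_(x in `[0, 1]) p (v x) - \int[mu]_(x in `[0, 1]) p (w x)
    - \int[mu]_(x in `[0, 1]) dotp (Z x) (residual f S v x)
    - dotp (Z alpha) jf - (beta - alpha) * c|
  <= eta + eta + e * `|beta - alpha| + `|dotp (Z beta - Z alpha) jf|.
Proof.
have alg (I1 I2 I3 k t za zb et ee : R) :
    `|I1| <= et -> `|I2 - k| <= ee -> `|I3| <= et -> zb - za = t ->
    `|I1 + I2 + I3 + zb - za - k| <= et + et + ee + `|t|.
  move=> H1 H2 H3 tE.
  have -> : I1 + I2 + I3 + zb - za - k = I1 + I3 + (I2 - k) + t by rewrite -tE; ring.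
  rewrite (le_trans (ler_normD _ _))// lerD2r (le_trans (ler_normD _ _))// lerD//.
  by rewrite (le_trans (ler_normD _ _))// lerD.
move=> /andP[al0 al1] /andP[be0 be1] Ca Cb Ch1 Ch2 va vb wh1 wh2 r1 r2 RH ab0 ab1.
move=> eta0 e0 c jf o1 o2 m1 m2.
have small (I : R) (l r : R) : 0 <= l -> l <= r -> r <= 1 ->
    `|I - 0 * (r - l)| <= eta * (r - l) -> `|I| <= eta.
  move=> l0 lr r1'; rewrite mul0r subr0 => /le_trans; apply.
  by rewrite ler_piMr// lerBlDr (le_trans r1')// lerDl.
have aeW0 (P Q : R -> Prop) : {ae mu, forall x, P x} -> (forall x, P x -> Q x) ->
    {ae mu, forall x, Q x}.
  by move=> aP PQ; apply: (@filterS _ _ (ae_filter_ringOfSetsType mu) _ _ PQ aP).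
have tE : dotp (Z beta) jf - dotp (Z alpha) jf = dotp (Z beta - Z alpha) jf.
  by rewrite dotpBl.
have [alb|bal] := leP alpha beta.
- have [|||i1 i2 i3 ->] := @adjoint_identity3 _ _ f S p Cf CS Cp Z q L ZL mq qL dZ
    v w a a b h1 h2 h2 alpha beta (ltW al0) alb (ltW be1)
    Ca Ca Cb Ch1 Ch2 Ch2 _ _ _ ab0 ab1.
  + move=> x /andP[x0 xa]; rewrite va ?x0 ?(lt_le_trans xa)// wh1 ?x0//.
    by rewrite r1// x0.
  + move=> x /andP[xa xb]; rewrite va ?(lt_trans al0)// wh2 ?xa ?(lt_trans xb)//.
    by rewrite r2// xa (lt_trans xb).
  + move=> x /andP[xb x1]; have xa := le_lt_trans alb xb.
    by rewrite vb ?xb// wh2 ?xa// r2// xa.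
  have nE : `|beta - alpha| = beta - alpha by rewrite ger0_norm ?subr_ge0.
  (* At [alpha] only [w] changes branch, and Rankine-Hugoniot cancels its term; at [beta] only [v]
     does, which leaves [dotp (Z beta) jf]. *)
  rewrite RH !subrr !dotp0 !addr0 nE.
  apply: alg => //.
  + apply: (small _ 0 alpha) => //; [exact: ltW|exact: ltW|].
    apply: Rintegral_ae_bound => //; first exact: ltW.
    apply: (aeW0 _ _ o1) => x H /andP[x0 xa]; rewrite subr0; apply: H.
      by rewrite x0.
    exact: lt_le_trans alb.
  + rewrite mulrC; apply: Rintegral_ae_bound => //.
    by apply: aeW => x; exact: m1.
  + apply: (small _ beta 1) => //; [exact: ltW|exact: ltW|].
    apply: Rintegral_ae_bound => //; first exact: ltW.
    apply: (aeW0 _ _ o2) => x H /andP[x0 xa]; rewrite subr0; apply: H => //.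
    by rewrite xa andbT (le_lt_trans alb).
- have bal' := ltW bal.
  have [|||i1 i2 i3 ->] := @adjoint_identity3 _ _ f S p Cf CS Cp Z q L ZL mq qL dZ
    v w a b b h1 h1 h2 beta alpha (ltW be0) bal' (ltW al1)
    Ca Cb Cb Ch1 Ch1 Ch2 _ _ _ ab0 ab1.
  + move=> x /andP[x0 xb]; have xa := lt_trans xb bal.
    by rewrite va ?x0// wh1 ?x0// r1// x0.
  + move=> x /andP[xb xa]; have x0 := lt_trans be0 xb; have x1 := lt_trans xa al1.
    by rewrite vb ?xb// wh1 ?x0// r1// x0.
  + move=> x /andP[xa x1]; have xb := lt_trans bal xa.
    by rewrite vb ?xb// wh2 ?xa// r2// xa.
  have nE : `|beta - alpha| = alpha - beta by rewrite ltr0_norm ?subr_lt0// opprB.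
  rewrite RH !subrr !dotp0 !addr0 nE.
  apply: alg => //.
  + apply: (small _ 0 beta) => //; [exact: ltW|exact: ltW|].
    apply: Rintegral_ae_bound => //; first exact: ltW.
    apply: (aeW0 _ _ o1) => x H /andP[x0 xb]; rewrite subr0; apply: H => //.
    by rewrite x0 (lt_trans xb).
  + have -> : (beta - alpha) * c = (- c) * (alpha - beta) by ring.
    apply: Rintegral_ae_bound => //.
    by apply: aeW => x xba; rewrite opprK; exact: m2.
  + apply: (small _ alpha 1) => //; [exact: ltW|exact: ltW|].
    apply: Rintegral_ae_bound => //; first exact: ltW.
    apply: (aeW0 _ _ o2) => x H /andP[xa x1]; rewrite subr0; apply: H => //.
      by rewrite xa.
    exact: lt_trans xa.
Qed.

End error_bound.

(** * The extended adjoint solution, and closeness of v to w *)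

Section adjoint_extension.
Context {R : realType} {d : nat}.
Local Notation V := 'rV[R]_d.
Notation mu := (@lebesgue_measure R).

Definition clamp01 (x : R) : R := Num.max 0 (Num.min x 1).

Lemma clamp01_id x : 0 <= x <= 1 -> clamp01 x = x.
Proof. by move=> /andP[x0 x1]; rewrite /clamp01 (min_idPl x1) (max_idPr x0). Qed.

Lemma clamp01_in x : 0 <= clamp01 x <= 1.
Proof. by rewrite /clamp01 le_max lexx/= ge_max ler01 ge_min lexx orbT. Qed.

Lemma clamp01_lipschitz x y : `|clamp01 x - clamp01 y| <= `|x - y|.
Proof.
wlog xy : x y / x <= y.
  by move=> H; have [/H//|/ltW/H] := leP x y; rewrite distrC (distrC y).
have cxy : clamp01 x <= clamp01 y.
  rewrite /clamp01 ge_max le_max lexx/= le_max; apply/orP; right.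
  by rewrite le_min !ge_min xy lexx orbT.
rewrite distrC (distrC x) !ger0_norm ?subr_ge0//.
rewrite /clamp01; clear cxy.
have [x1|x1] := leP x 1; have [y1|y1] := leP y 1; rewrite ?(max_idPr ler01);
  have [x0|x0] := leP 0 x; have [y0|y0] := leP 0 y; lra.
Qed.

(** Composition with the 1-Lipschitz projection [clamp01] extends [z] by its end values and keeps
    the Lipschitz bound. Coordinatewise measurable substitutes for the derivative form [q], which
    agrees with the derivative of [z] wherever that exists in the open interval. *)
Lemma adjoint_extension (f S : V -> V) (p : V -> R) (alpha : R) (w z : R -> V) :
  adjoint_solution f S p alpha w z ->
  exists (Z q : R -> V) (L : R),
  [/\ forall x, 0 <= x <= 1 -> Z x = z x,
      forall x y, `|Z x - Z y| <= L * `|x - y|,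
      (forall i, measurable_fun setT (fun x => q x 0 i)) /\ (forall x, `|q x| <= L),
      {ae mu, forall x : R, 0 < x < 1 -> is_derive x 1 Z (q x)} &
      {ae mu, forall x : R, 0 < x < 1 -> x != alpha ->
        - (q x *m ('J f (w x))^T) + Z x *m ('J S (w x))^T = gradient p (w x)}].
Proof.
move=> [lipz adj].
have [L zL] : exists L, forall x y, 0 <= x <= 1 -> 0 <= y <= 1 ->
    `|z x - z y| <= L * `|x - y|.
  move: lipz; rewrite /lipschitz_on => /filter_ex[L HL]; exists L => x y x01 y01.
  by apply: (HL (x, y)); split; rewrite /= in_itv.
pose Z x := z (clamp01 x).
have ZL x y : `|Z x - Z y| <= `|L| * `|x - y|.
  rewrite (le_trans (zL _ _ (clamp01_in x) (clamp01_in y)))//.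
  by rewrite (le_trans (ler_wpM2r _ (ler_norm L)))// ler_wpM2l// clamp01_lipschitz.
have ZiL i x y : `|Z x 0 i - Z y 0 i| <= `|L| * `|x - y|.
  rewrite (le_trans _ (ZL x y))//.
  by have := normr_coord_le (Z x - Z y) i; rewrite !mxE.
pose Q i := cid (lipschitz_measurable_derive (ZiL i)).
pose q x : V := \row_i sval (Q i) x.
have qE x : 0 < x < 1 -> derivable z x 1 ->
    is_derive x 1 Z (q x) /\ q x = z^`() x.
  move=> x01 dz.
  have zZ : \forall y \near x, z y = Z y.
    apply: filterS (near_oo x01) => y /andP[y0 y1].
    by rewrite /Z clamp01_id// !ltW.
  have dZ : derivable Z x 1 by exact: near_eq_derivable dz.
  have qD : q x = 'D_1 Z x.
    apply/rowP => i; rewrite mxE (derive_mx dZ) mxE.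
    by have [_ _ ->//] := svalP (Q i); exact: (derivable_mxP _ _ _).1.
  split; first by rewrite qD; exact: derivableP.
  by rewrite derive1E (near_eq_derive _ zZ).
exists Z, q, `|L|; split => //.
- by move=> x x01; rewrite /Z clamp01_id.
- split=> [i|x].
    rewrite (_ : (fun x => _) = sval (Q i)); last by apply/funext => x; rewrite mxE.
    by have [] := svalP (Q i).
  by apply: normr_le_coord => // i; rewrite mxE; have [_ ->] := svalP (Q i).
- apply: (@filterS2 _ _ (ae_filter_ringOfSetsType mu) _ _ _ _ adj (ae_neq alpha)).
  by move=> x H xa x01; apply: (qE x x01 (H x01 xa).1).1.
- apply: (@filterS _ _ (ae_filter_ringOfSetsType mu) _ _ _ adj) => x H x01 xa.
  have [dz adjx] := H x01 xa; rewrite (qE x x01 dz).2.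
  by move/andP: (x01) => [x0 x1]; rewrite /Z clamp01_id// !ltW.
Qed.

End adjoint_extension.

(** * Bijections of intervals with derivative close to 1 *)

Section near_identity.
Context {R : realType}.

(** A derivative close to 1 makes [xi] increasing, which excludes an orientation-reversing bijection
    and sends end points to end points in order. The Lipschitz bound on [xi] minus the identity is
    the mean value theorem; as [xi1] fixes 0 and [xi2] fixes 1, it shows that both move points by
    [O(nu)]. *)
Lemma near_identity_bijection (xi : R -> R) (a b a' b' e : R) :
  a < b -> e < 1 -> smooth_on `[a, b] (xi : R -> R^o) ->
  set_bij `[a, b] `[a', b'] xi ->
  (forall x : R, a < x < b -> `|xi^`()%classic x - 1| <= e) ->
  [/\ xi a = a', xi b = b' & forall x y, a <= x <= b -> a <= y <= b ->
    `|(xi x - x) - (xi y - y)| <= e * `|x - y|].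
Proof.
move=> ab e1 [h [/(_ 1%N) [dh _] xih]] [fxi _ sxi] xi1.
have xiE x : a <= x <= b -> xi x = h x by move=> xab; apply: xih; rewrite /= in_itv.
have dhE x : a < x < b -> `|'D_1 (h : R -> R) x - 1| <= e.
  move=> xab; have <- : xi^`()%classic x = 'D_1 (h : R -> R) x.
    rewrite -derive1E; apply: (@eq_oo_derive1 _ R^o _ _ a b) => // y /andP[ay yb].
    by apply: xiE; rewrite !ltW.
  exact: xi1.
have key x y : a <= x -> x < y -> y <= b ->
    `|(xi y - y) - (xi x - x)| <= e * (y - x).
  move=> ax xy yb; pose g t : R := h t - t.
  have dg (t : R) : is_derive t 1 g ('D_1 (h : R -> R) t - 1).
    by apply: is_deriveB; apply: derivableP; apply/derivable1_diffP; exact: dh.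
  have cg : {within `[x, y], continuous g}.
    apply: continuous_subspaceT => t; apply/differentiable_continuous.
    exact/derivable1_diffP.
  have [t] := MVT xy (fun t _ => dg t) cg.
  rewrite in_itv/= => /andP[xt ty] E.
  rewrite !xiE ?ax ?yb ?(le_trans ax (ltW xy))//; last by rewrite (le_trans (ltW xy)).
  rewrite -/(g y) -/(g x) E normrM (ger0_norm (x := y - x)) ?subr_ge0 ?(ltW xy)//.
  by rewrite ler_wpM2r ?subr_ge0 ?(ltW xy)// dhE// (le_lt_trans ax)// (lt_le_trans ty).
have incr x y : a <= x -> x < y -> y <= b -> xi x < xi y.
  move=> ax xy yb; have := key x y ax xy yb; rewrite ler_norml => /andP[+ _].
  have : 0 < (1 - e) * (y - x) by rewrite mulr_gt0 ?subr_gt0.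
  by clear; lra.
have aab : a <= a <= b by rewrite lexx ltW.
have bab : a <= b <= b by rewrite lexx ltW.
have xin x : a <= x <= b -> a' <= xi x <= b'.
  by move=> xab; have := fxi x; rewrite /= !in_itv/=; apply.
have /andP[a'b' _] : a' <= b' <= b'.
  by have /andP[h1 h2] := xin a aab; rewrite lexx (le_trans h1).
have sur y : a' <= y <= b' -> exists2 x, a <= x <= b & xi x = y.
  move=> yab; have [|x] := sxi y; first by rewrite /= in_itv.
  by rewrite /= in_itv => xab <-; exists x.
split.
- have [t /andP[at_ tb] tE] := sur a' (introT andP (conj (lexx a') a'b')).
  move: at_; rewrite le_eqVlt => /predU1P[->//|at_].
  have := incr a t (lexx a) at_ tb; rewrite tE => lt1.
  by have /andP[] := xin a aab; rewrite leNgt lt1.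
- have [t /andP[at_ tb] tE] := sur b' (introT andP (conj a'b' (lexx b'))).
  move: tb; rewrite le_eqVlt => /predU1P[<-//|tb].
  have := incr t b at_ tb (lexx b); rewrite tE => lt1.
  by have /andP[_] := xin b bab; rewrite leNgt lt1.
- move=> x y /andP[ax xb] /andP[ay yb]; have [xy|yx|->] := ltgtP x y.
  + rewrite distrC (distrC x) (ger0_norm (x := y - x)) ?subr_ge0 ?(ltW xy)//.
    exact: key.
  + by rewrite (ger0_norm (x := x - y)) ?subr_ge0 ?(ltW yx)//; exact: key.
  + by rewrite !subrr normr0 mulr0.
Qed.

End near_identity.

(** * Comparison of v and w at the same point *)

Section closeness.
Context {R : realType} {d : nat}.
Local Notation V := 'rV[R]_d.

Lemma near_right_mulr_lt (D e : R) : 0 <= D -> 0 < e ->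
  \forall nu \near 0^'+, D * nu < e.
Proof.
move=> D0 e0; have D1 : 0 < D + 1 by rewrite ltr_wpDl.
near=> nu; have nu0 : 0 < nu by near: nu; exact: nbhs_right_gt.
apply: (@lt_trans _ _ ((D + 1) * nu)); first by rewrite ltr_pM2r// ltrDl.
by rewrite -ltr_pdivlMl//; near: nu; apply: nbhs_right_lt; rewrite mulr_gt0 ?invr_gt0.
Unshelve. all: by end_near. Qed.

Lemma unifO_ge0 (W : normedModType R) (A : R -> set R) (g : R -> R -> W) :
  unifO A g id -> exists2 C, 0 <= C &
    \forall nu \near 0^'+, forall x, A nu x -> `|g nu x| <= C * nu.
Proof.
move=> [C HC]; exists `|C|; first exact: normr_ge0.
near=> nu => x Ax; have nu0 : 0 < nu by near: nu; exact: nbhs_right_gt.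
have gC : forall x, A nu x -> `|g nu x| <= C * `|id nu| by near: nu.
by rewrite (le_trans (gC x Ax))// (gtr0_norm nu0) ler_wpM2r ?ler_norm ?(ltW nu0).
Unshelve. all: by end_near. Qed.

(** A point [x] is written as the image of some [y] under [xi1] or [xi2]: [v] at [x] is close to the
    branch of [w] at [y], and moving back from [y] to [x] costs a Lipschitz constant of that branch,
    which does not depend on [nu]. *)
Lemma approximates_close (f S : V -> V) (w : R -> V) (alpha : R)
    (v : R -> R -> V) (beta mu : R -> R) (h1 h2 : R -> V) :
  classC 1 (h1 : R^o -> V) -> classC 1 (h2 : R^o -> V) ->
  (forall x, 0 <= x < alpha -> w x = h1 x) ->
  (forall x, alpha < x <= 1 -> w x = h2 x) ->
  approximates f S w alpha v beta mu ->
  exists2 K, 0 <= K & \forall nu \near 0^'+,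
    [/\ 0 < beta nu < 1, `|beta nu - alpha| <= K * nu,
        forall x, 0 <= x < beta nu -> `|v nu x - h1 x| <= K * nu &
        forall x, beta nu < x <= 1 -> `|v nu x - h2 x| <= K * nu].
Proof.
move=> Ch1 Ch2 wh1 wh2 [xi1 [xi2 [[al01 be01] [bij1 bij2 wv1 wv2] [d1 d2 xib _ _] _]]].
have /andP[al0 al1] := al01.
have [C1 C10 {}wv1] := unifO_ge0 wv1; have [C2 C20 {}wv2] := unifO_ge0 wv2.
have [D1 D10 {}d1] := unifO_ge0 d1; have [D2 D20 {}d2] := unifO_ge0 d2.
have [L1 L10 h1L] := classC1_lipschitz 0 1 Ch1.
have [L2 L20 h2L] := classC1_lipschitz 0 1 Ch2.
(* The summands bound, in turn, the shift of the discontinuity and the distance between [v] and [w]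
   on the left and on the right. *)
pose K := D1 + (C1 + L1 * D1) + (C2 + L2 * D2).
have LD1 : 0 <= L1 * D1 by rewrite mulr_ge0.
have LD2 : 0 <= L2 * D2 by rewrite mulr_ge0.
have [K1 K2 K3 K0] : [/\ D1 <= K, C1 + L1 * D1 <= K, C2 + L2 * D2 <= K & 0 <= K].
  by rewrite /K; split; lra.
exists K => //; near=> nu.
have nu0 : 0 < nu by near: nu; exact: nbhs_right_gt.
have D1nu : D1 * nu < 1 by near: nu; exact: near_right_mulr_lt.
have D2nu : D2 * nu < 1 by near: nu; exact: near_right_mulr_lt.
have /andP[be0 be1] : 0 < beta nu < 1 by near: nu.
have [xi1b xi2b] : xi1 nu alpha = beta nu /\ xi2 nu alpha = beta nu by near: nu.
have [sm1 bj1] : smooth_on `[0, alpha] (xi1 nu : R -> R^o) /\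
  set_bij `[0, alpha] `[0, beta nu] (xi1 nu) by near: nu.
have [sm2 bj2] : smooth_on `[alpha, 1] (xi2 nu : R -> R^o) /\
  set_bij `[alpha, 1] `[beta nu, 1] (xi2 nu) by near: nu.
have dx1 : forall x, `]0, alpha[%classic x -> `|(xi1 nu)^`()%classic x - 1| <= D1 * nu.
  by near: nu.
have dx2 : forall x, `]alpha, 1[%classic x -> `|(xi2 nu)^`()%classic x - 1| <= D2 * nu.
  by near: nu.
have wx1 : forall x, `[0, alpha[%classic x -> `|w x - v nu (xi1 nu x)| <= C1 * nu.
  by near: nu.
have wx2 : forall x, `]alpha, 1]%classic x -> `|w x - v nu (xi2 nu x)| <= C2 * nu.
  by near: nu.
have dx1' x : 0 < x < alpha -> `|(xi1 nu)^`()%classic x - 1| <= D1 * nu.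
  by move=> x0a; apply: dx1; rewrite /= in_itv.
have dx2' x : alpha < x < 1 -> `|(xi2 nu)^`()%classic x - 1| <= D2 * nu.
  by move=> xa1; apply: dx2; rewrite /= in_itv.
have [x10 x1a x1c] := near_identity_bijection al0 D1nu sm1 bj1 dx1'.
have [x2a x21 x2c] := near_identity_bijection al1 D2nu sm2 bj2 dx2'.
have bound (h : R -> V) (L C D x y : R) : 0 <= D -> 0 <= L ->
    (forall x y, 0 <= x <= 1 -> 0 <= y <= 1 -> `|h x - h y| <= L * `|x - y|) ->
    0 <= x <= 1 -> 0 <= y <= 1 -> C + L * D <= K ->
    `|h y - v nu x| <= C * nu -> `|x - y| <= D * nu -> `|v nu x - h x| <= K * nu.
  move=> D0 L0 hL x01 y01 CK hy xy.
  rewrite (@le_trans _ _ ((C + L * D) * nu))// ?ler_wpM2r ?(ltW nu0)//.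
  rewrite -(subrKA (h y)) (le_trans (ler_normD _ _))// mulrDl lerD//.
    by rewrite distrC.
  by rewrite (le_trans (hL _ _ y01 x01))// -mulrA ler_wpM2l// distrC.
split.
- by rewrite be0.
(* As [xi1] fixes 0 and sends [alpha] to [beta nu], the shift is at most [D1 * nu * alpha]. *)
- have := x1c alpha 0; rewrite x10 x1a subrr !subr0 !lexx ltW//= (gtr0_norm al0).
  move=> /(_ isT isT)/le_trans; apply; rewrite -mulrA (le_trans _ (_ : D1 * nu <= _))//.
    by rewrite ler_wpM2l// ler_piMr ?ltW.
  by rewrite ler_wpM2r ?(ltW nu0).
- move=> x /andP[x0 xb]; have [_ _ sx] := bj1.
  have [|y] := sx x; first by rewrite /= in_itv/= x0 ltW.
  rewrite /= in_itv/= => /andP[y0 ya] yx.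
  (* The bound on [w] minus [v] is given strictly left of [alpha]; [y = alpha] would force
     [x = beta nu]. *)
  have {}ya : y < alpha.
    by rewrite lt_neqAle ya andbT; apply: contraTneq xb => yE; rewrite -yx yE x1a ltxx.
  have y01 : 0 <= y <= 1 by rewrite y0 (le_trans (ltW ya))// ltW.
  have x01 : 0 <= x <= 1 by rewrite x0 (le_trans (ltW xb))// ltW.
  apply: (bound h1 L1 C1 D1 x y) => //.
    by rewrite -yx -wh1 ?y0//; apply: wx1; rewrite /= in_itv/= y0.
  have := x1c y 0; rewrite x10 subrr !subr0 yx lexx y0 (ltW ya) (ltW al0)/=.
  move=> /(_ isT isT)/le_trans; apply; rewrite ger0_norm// -[leRHS]mulr1.
  by rewrite ler_wpM2l ?mulr_ge0 ?(ltW nu0)// (andP y01).2.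
- move=> x /andP[xb x1]; have [_ _ sx] := bj2.
  have [|y] := sx x; first by rewrite /= in_itv/= x1 ltW.
  rewrite /= in_itv/= => /andP[ya y1] yx.
  have {}ya : alpha < y.
    rewrite lt_neqAle ya andbT; apply: contraTneq xb => yE.
    by rewrite -yx -yE x2a ltxx.
  have y01 : 0 <= y <= 1 by rewrite y1 (le_trans (ltW al0))// ltW.
  have x01 : 0 <= x <= 1 by rewrite x1 (le_trans (ltW be0))// ltW.
  apply: (bound h2 L2 C2 D2 x y) => //.
    by rewrite -yx -wh2 ?ya//; apply: wx2; rewrite /= in_itv/= ya.
  have := x2c y 1; rewrite x21 subrr !subr0 yx lexx y1 (ltW ya) (ltW al1)/=.
  move=> /(_ isT isT)/le_trans; apply.
  rewrite distrC ger0_norm ?subr_ge0// -[leRHS]mulr1.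
  by rewrite ler_wpM2l ?mulr_ge0 ?(ltW nu0)// lerBlDr lerDl (andP y01).1.
Unshelve. all: by end_near. Qed.

End closeness.

(** * The defect across the jump, and expansions near the branches of w *)

Section near_curve.
Context {R : realType} {d : nat}.
Local Notation V := 'rV[R]_d.

(* v and w near opposite sides y0 and u0 of the jump: the term of q drops out
   because f does not jump. *)
Lemma adjoint_defect_jump (f S : V -> V) (p : V -> R)
    (z q u y z0 u0 y0 : V) (M N e : R) :
  f u0 = f y0 ->
  `|f y - f y0| <= e -> `|S y - S y0| <= e -> `|p y - p y0| <= e ->
  `|f u - f u0| <= e -> `|S u - S u0| <= e -> `|p u - p u0| <= e ->
  `|z - z0| <= e -> `|z| <= M -> `|q| <= M -> `|S y0 - S u0| <= N ->
  `|adjoint_defect f S p z q u y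
    - (p y0 - p u0 - dotp z0 (S y0 - S u0))| <= (2 + d%:R * (4 * M + N)) * e.
Proof.
have alg (py py0 pu pu0 zy zu zy0 zu0 z0y z0u t : R) :
  py - pu - (zy - zu) + t - (py0 - pu0 - (z0y - z0u)) =
  (py - py0) - (pu - pu0) - ((zy - zy0) - (zu - zu0))
    - (zy0 - zu0 - (z0y - z0u)) + t by ring.
have bd (a b c e1 e2 : R) (m : R) : `|a| <= m -> `|b| <= m -> `|c| <= e1 ->
    forall r s, `|r| <= e2 -> `|s| <= e1 ->
    `|a - b - c - r + s| <= m + m + e1 + e2 + e1.
  move=> am bm ce r s re se.
  rewrite (le_trans (ler_normD _ _))// lerD// (le_trans (ler_normB _ _))// lerD//.
  rewrite (le_trans (ler_normB _ _))// lerD// (le_trans (ler_normB _ _))// lerD//.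
move=> fE fy Sy py fu Su pu zz zM qM SN.
have e0 : 0 <= e by exact: le_trans zz.
have M0 : 0 <= M by exact: le_trans zM.
have dM (a b b' : V) : `|a| <= M -> `|b| <= e -> `|b'| <= e ->
    `|dotp a b - dotp a b'| <= d%:R * (M * (e + e)).
  move=> aM be b'e; rewrite -dotpBr (le_trans (norm_dotp_le _ _))// ler_wpM2l//.
  by rewrite ler_pM// (le_trans (ler_normB _ _))// lerD.
rewrite /adjoint_defect (dotpBr z) (dotpBr z0).
rewrite (alg _ (p y0) _ (p u0) _ _ (dotp z (S y0)) (dotp z (S u0))).
have -> : f y - f u = (f y - f y0) - (f u - f u0) by rewrite fE opprB addrA subrK.
rewrite dotpBr -!(dotpBr z) -(dotpBr z0) -(dotpBl z z0).
(* Two errors of [p], two of [S] against [z], the change from [z] to [z0] against the jump of [S],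
   and two errors of [f] against [q]. *)
rewrite (_ : _ * e = e + e + d%:R * (M * (e + e)) + d%:R * (e * N)
  + d%:R * (M * (e + e))).
  apply: bd => //; [|by rewrite (le_trans (norm_dotp_le _ _))// ler_wpM2l// ler_pM|].
    by rewrite dotpBr; exact: dM.
  exact: dM.
by ring.
Qed.

(** Both orders share one radius and one tolerance: the bound of order zero serves near the jump,
    the first-order one away from it. *)
Definition taylor_near_curve (W : normedModType R) (dl e : R) (F : V -> W)
    (h : R -> V) := forall x y, 0 <= x <= 1 -> `|y - h x| < dl ->
  `|F y - F (h x)| <= e /\
  `|F y - F (h x) - 'D_(y - h x) F (h x)| <= e * `|y - h x|.

Lemma classC1_near_curve m (F : V -> 'rV[R]_m) (h : R -> V) (e : R) :
  classC 1 F -> continuous h -> 0 < e ->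
  \forall dl \near 0^'+, taylor_near_curve dl e F h.
Proof.
move=> CF ch e0.
apply: filterS2 (continuous_near_segment 0 1 (classC_continuous CF) ch e0)
  (taylor1_near_segment_rV 0 1 CF ch e0) => dl H1 H2 x y x01 yx.
by split; [exact: H1|exact: H2].
Qed.

Lemma classC1_near_curve_scalar (F : V -> R) (h : R -> V) (e : R) :
  classC 1 (F : V -> R^o) -> continuous h -> 0 < e ->
  \forall dl \near 0^'+, taylor_near_curve dl e (F : V -> R^o) h.
Proof.
move=> CF ch e0.
apply: filterS2
  (@continuous_near_segment _ _ R^o F h 0 1 e (classC_continuous CF) ch e0)
  (taylor1_near_segment 0 1 CF ch e0) => dl H1 H2 x y x01 yx.
by split; [exact: H1|exact: H2].
Qed.

(** Closeness of [v] to [w] says nothing at [beta]; the smooth branch of [v] inherits it there by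
    continuity, as the jump of [f v] requires. *)
Lemma norm_le_left_end (g : R -> V) (l b C : R) : l < b -> {for b, continuous g} ->
  (forall x, l < x < b -> `|g x| <= C) -> `|g b| <= C.
Proof.
move=> lb cg gC; have gb : g x @[x --> b^'-] --> g b := cvg_at_left_filter cg.
apply: (cvg_norm_le gb).
near=> x; apply: gC; apply/andP; split; near: x.
  exact: nbhs_left_gt.
exact: nbhs_left_lt.
Unshelve. all: by end_near. Qed.

Lemma norm_le_right_end (g : R -> V) (a r C : R) : a < r -> {for a, continuous g} ->
  (forall x, a < x < r -> `|g x| <= C) -> `|g a| <= C.
Proof.
move=> lb cg gC; have ga : g x @[x --> a^'+] --> g a := cvg_at_right_filter cg.
apply: (cvg_norm_le ga).
near=> x; apply: gC; apply/andP; split; near: x.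
  exact: nbhs_right_gt.
exact: nbhs_right_lt.
Unshelve. all: by end_near. Qed.

End near_curve.

(** * The quantitative error estimate *)

Section error_estimate.
Context {R : realType} {d : nat}.
Local Notation V := 'rV[R]_d.
Notation mu := (@lebesgue_measure R).
Variables (f S : V -> V) (p : V -> R).
Hypotheses (Cf : classC 1 f) (CS : classC 1 S) (Cp : classC 1 (p : V -> R^o)).
Variables (Z q : R -> V) (L : R).
Hypotheses (ZL : forall x y, `|Z x - Z y| <= L * `|x - y|)
  (mq : forall i, measurable_fun setT (fun x => q x 0 i))
  (qL : forall x, `|q x| <= L)
  (dZ : {ae mu, forall x : R, 0 < x < 1 -> is_derive x 1 Z (q x)}).

Variables (w h1 h2 : R -> V) (alpha M N L1 L2 : R).
Hypotheses (al01 : 0 < alpha < 1)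
  (Ch1 : classC 1 (h1 : R^o -> V)) (Ch2 : classC 1 (h2 : R^o -> V))
  (wh1 : forall x, 0 < x < alpha -> w x = h1 x)
  (wh2 : forall x, alpha < x < 1 -> w x = h2 x)
  (r1 : forall x, 0 < x < alpha -> residual f S h1 x = 0)
  (r2 : forall x, alpha < x < 1 -> residual f S h2 x = 0)
  (RH : f (h1 alpha) = f (h2 alpha))
  (adj : {ae mu, forall x : R, 0 < x < 1 -> x != alpha ->
    - (q x *m ('J f (w x))^T) + Z x *m ('J S (w x))^T = gradient p (w x)})
  (ZM : forall x, 0 <= x <= 1 -> `|Z x| <= M) (LM : L <= M)
  (SN : `|S (h1 alpha) - S (h2 alpha)| <= N) (L10 : 0 <= L1) (L20 : 0 <= L2)
  (h1L : forall x y, 0 <= x <= 1 -> 0 <= y <= 1 -> `|h1 x - h1 y| <= L1 * `|x - y|)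
  (h2L : forall x y, 0 <= x <= 1 -> 0 <= y <= 1 -> `|h2 x - h2 y| <= L2 * `|x - y|).

(** Here [kn] stands for [K * nu]. The product [e * kn] arises three times: as a Taylor remainder
    over a distance [kn], as an error [e] integrated over a length [kn], and as a displacement
    [L * kn] of [Z] paired with a jump of [f v] of size [2 * e]. The remaining factor is independent
    of [v]. *)
Lemma adjoint_error_estimate (v a b : R -> V) (beta kn dl e : R) :
  0 < beta < 1 -> classC 1 (a : R^o -> V) -> classC 1 (b : R^o -> V) ->
  (forall x, 0 < x < beta -> v x = a x) -> (forall x, beta < x < 1 -> v x = b x) ->
  a 0 = h1 0 -> b 1 = h2 1 -> 0 < e ->
  taylor_near_curve dl e f h1 -> taylor_near_curve dl e f h2 ->
  taylor_near_curve dl e S h1 -> taylor_near_curve dl e S h2 ->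
  taylor_near_curve dl e (p : V -> R^o) h1 ->
  taylor_near_curve dl e (p : V -> R^o) h2 ->
  kn + (L1 + L2) * kn < dl -> L * kn <= e -> `|beta - alpha| <= kn ->
  (forall x, 0 <= x <= beta -> `|a x - h1 x| <= kn) ->
  (forall x, beta <= x <= 1 -> `|b x - h2 x| <= kn) ->
  `|\int[mu]_(x in `[0, 1]) p (v x) - \int[mu]_(x in `[0, 1]) p (w x)
    - \int[mu]_(x in `[0, 1]) dotp (Z x) (residual f S v x)
    - dotp (Z alpha) (f (b beta) - f (a beta))
    - (beta - alpha) * (p (h1 alpha) - p (h2 alpha)
                        - dotp (Z alpha) (S (h1 alpha) - S (h2 alpha)))|
  <= e * kn * (2 * (1 + 2 * (d%:R * M)) + (2 + d%:R * (4 * M + N))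
       + 2 * (d%:R * L)).
Proof.
move=> be01 Ca Cb va vb ab0 ab1 e0 f1 f2 S1 S2 p1 p2 kndl Lkn bak ca cb.
pose c := p (h1 alpha) - p (h2 alpha)
  - dotp (Z alpha) (S (h1 alpha) - S (h2 alpha)).
pose jf := f (b beta) - f (a beta).
have L0 : 0 <= L by rewrite (le_trans _ (qL 0)).
have M0 : 0 <= M by exact: le_trans LM.
have N0 : 0 <= N by exact: le_trans SN.
have kn0 : 0 <= kn by exact: le_trans bak.
have qM x : `|q x| <= M by exact: le_trans LM.
have /andP[al0 al1] := al01; have /andP[be0 be1] := be01.
have al01' : 0 <= alpha <= 1 by rewrite !ltW.
have be01' : 0 <= beta <= 1 by rewrite !ltW.
have kdl : kn < dl by rewrite (le_lt_trans _ kndl)// lerDl mulr_ge0// addr_ge0.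
have CM0 : 0 <= 2 + d%:R * (4 * M + N).
  by rewrite addr_ge0// mulr_ge0// addr_ge0// mulr_ge0.
have CT0 : 0 <= 1 + 2 * (d%:R * M) by rewrite addr_ge0// !mulr_ge0.
(* Near the jump everything is compared with its value at [alpha]: [kn] to reach the branch of [w]
   and at most [(L1 + L2) * kn] to slide along it. *)
have near_end (h : R -> V) (l : R) : 0 <= l -> l <= L1 + L2 ->
    (forall x y, 0 <= x <= 1 -> 0 <= y <= 1 -> `|h x - h y| <= l * `|x - y|) ->
    forall x y, 0 <= x <= 1 -> `|x - alpha| <= kn -> `|y - h x| <= kn ->
    `|y - h alpha| < dl.
  move=> l0 l12 hL x y x01 xa yx; apply: le_lt_trans kndl.
  rewrite -(subrKA (h x)) (le_trans (ler_normD _ _))// lerD//.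
  by rewrite (le_trans (hL _ _ x01 al01'))// ler_pM.
have l1 : L1 <= L1 + L2 by rewrite lerDl.
have l2 : L2 <= L1 + L2 by rewrite lerDr.
have near1 := near_end h1 L1 L10 l1 h1L; have near2 := near_end h2 L2 L20 l2 h2L.
have out (A h : R -> V) (x : R) : taylor_near_curve dl e f h ->
    taylor_near_curve dl e S h -> taylor_near_curve dl e (p : V -> R^o) h ->
    0 <= x <= 1 -> `|A x - h x| <= kn ->
    - (q x *m ('J f (h x))^T) + Z x *m ('J S (h x))^T = gradient p (h x) ->
    `|adjoint_defect f S p (Z x) (q x) (h x) (A x)| <= (1 + 2 * (d%:R * M)) * (e * kn).
  move=> Tf TS Tp x01 Ax adjx; have Axd := le_lt_trans Ax kdl.
  have le_e t : t <= e * `|A x - h x| -> t <= e * kn.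
    by move/le_trans; apply; rewrite ler_wpM2l// ltW.
  apply: adjoint_linearization => //; [exact: Cf.1|exact: CS.1|exact: Cp.1| | |
    |exact: ZM].
  - by apply: le_e; have [] := Tf x (A x) x01 Axd.
  - by apply: le_e; have [] := TS x (A x) x01 Axd.
  - by apply: le_e; have [] := Tp x (A x) x01 Axd.
(* Both one-sided values of [f v] are within [e] of the common value of [f] at [h1 alpha] and
   [h2 alpha]. *)
have jfe : `|jf| <= 2 * e.
  have [fb _] := f2 alpha (b beta) al01'
    (near2 beta _ be01' bak (cb _ (introT andP (conj (lexx beta) (ltW be1))))).
  have [fa _] := f1 alpha (a beta) al01'
    (near1 beta _ be01' bak (ca _ (introT andP (conj (ltW be0) (lexx beta))))).
  rewrite /jf -(subrKA (f (h2 alpha))) -{2}RH mulr_natl.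
  by rewrite (le_trans (ler_normD _ _))// lerD// distrC.
have := @adjoint_error_bound _ _ f S p Cf CS Cp Z q L ZL mq qL dZ v w a b h1 h2
  alpha beta ((1 + 2 * (d%:R * M)) * (e * kn)) ((2 + d%:R * (4 * M + N)) * e)
  al01 be01 Ca Cb Ch1 Ch2 va vb wh1 wh2 r1 r2 RH ab0 ab1.
rewrite -/c -/jf => H; apply: le_trans (H _ _ _ _ _ _) _.
- by rewrite mulr_ge0// mulr_ge0// ltW.
- by rewrite mulr_ge0// ltW.
- apply: (@filterS _ _ (ae_filter_ringOfSetsType mu) _ _ _ adj) => x Hx /andP[x0 xa] xb.
  have x1 := lt_trans xa al1.
  apply: out => //; first by rewrite !ltW.
    by apply: ca; rewrite !ltW.
  by rewrite -wh1 ?x0//; apply: Hx; rewrite ?x0// lt_eqF.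
- apply: (@filterS _ _ (ae_filter_ringOfSetsType mu) _ _ _ adj) => x Hx /andP[xa x1] xb.
  have x0 := lt_trans al0 xa.
  apply: out => //; first by rewrite !ltW.
    by apply: cb; rewrite !ltW.
  by rewrite -wh2 ?xa//; apply: Hx; rewrite ?x0// gt_eqF.
- move=> x /andP[xa xb]; have x01 : 0 <= x <= 1.
    by rewrite (ltW (lt_trans al0 xa)) (ltW (lt_trans xb be1)).
  have xal : `|x - alpha| <= kn.
    rewrite (le_trans _ bak)// (ger0_norm (x := x - alpha)) ?subr_ge0 ?(ltW xa)//.
    by rewrite ger0_norm ?subr_ge0 ?(ltW (lt_trans xa xb))// lerD2r ltW.
  have na : `|a x - h1 alpha| < dl.
    by apply: (near1 x) => //; apply: ca; rewrite (ltW xb) (andP x01).1.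
  have nh : `|h2 x - h2 alpha| < dl by apply: (near2 x) => //; rewrite subrr normr0.
  apply: adjoint_defect_jump => //.
  + exact: (f1 alpha _ al01' na).1.
  + exact: (S1 alpha _ al01' na).1.
  + exact: (p1 alpha _ al01' na).1.
  + exact: (f2 alpha _ al01' nh).1.
  + exact: (S2 alpha _ al01' nh).1.
  + exact: (p2 alpha _ al01' nh).1.
  + by rewrite (le_trans (ZL _ _))// (le_trans _ Lkn)// ler_wpM2l.
  + exact: ZM.
- move=> x /andP[xb xa]; have x01 : 0 <= x <= 1.
    by rewrite (ltW (lt_trans be0 xb)) (ltW (lt_trans xa al1)).
  have xal : `|x - alpha| <= kn.
    rewrite (le_trans _ bak)// (ler0_norm (x := x - alpha)) ?subr_le0 ?(ltW xa)//.
    by rewrite ler0_norm ?subr_le0 ?(ltW (lt_trans xb xa))// lerN2 lerD2r ltW.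
  have nb : `|b x - h2 alpha| < dl.
    by apply: (near2 x) => //; apply: cb; rewrite (ltW xb) (andP x01).2.
  have nh : `|h1 x - h1 alpha| < dl by apply: (near1 x) => //; rewrite subrr normr0.
  (* With [beta] on the left of [alpha], the branches exchange their roles, and [c] is odd under
     this exchange. *)
  have -> : c = - (p (h2 alpha) - p (h1 alpha)
      - dotp (Z alpha) (S (h2 alpha) - S (h1 alpha))).
    by rewrite /c -(opprB (S (h1 alpha))) dotpNr; ring.
  apply: adjoint_defect_jump => //.
  + exact: (f2 alpha _ al01' nb).1.
  + exact: (S2 alpha _ al01' nb).1.
  + exact: (p2 alpha _ al01' nb).1.
  + exact: (f1 alpha _ al01' nh).1.
  + exact: (S1 alpha _ al01' nh).1.
  + exact: (p1 alpha _ al01' nh).1.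
  + by rewrite (le_trans (ZL _ _))// (le_trans _ Lkn)// ler_wpM2l.
  + exact: ZM.
  + by rewrite distrC.
- set CT := 1 + _; set CM := 2 + d%:R * _.
  have E1 : CM * e * `|beta - alpha| <= CM * e * kn.
    by rewrite ler_wpM2l// mulr_ge0// ltW.
  have E2 : `|dotp (Z beta - Z alpha) jf| <= d%:R * (L * kn * (2 * e)).
    rewrite (le_trans (norm_dotp_le _ _))// ler_wpM2l// ler_pM//.
    by rewrite (le_trans (ZL _ _))// ler_wpM2l.
  apply: (@le_trans _ _ (CT * (e * kn) + CT * (e * kn) + CM * e * kn
    + d%:R * (L * kn * (2 * e)))); first by rewrite !lerD.
  by rewrite le_eqVlt; apply/orP; left; apply/eqP; ring.
Qed.

End error_estimate.

(** * Conclusion as nu tends to 0 *)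

Theorem theorem1 (R : realType) (d : nat) (f S : 'rV[R]_d -> 'rV[R]_d)
    (p : 'rV[R]_d -> R) (w z : R -> 'rV[R]_d) (alpha : R)
    (v : R -> R -> 'rV[R]_d) (beta mu : R -> R)
    (hf : smooth f) (hS : smooth S) (hp : classC 2 (p : 'rV[R]_d -> R^o))
    (hw : piecewise_smooth alpha w) (hsol : exact_solution f S alpha w)
    (hv : \forall nu \near 0^'+, piecewise_smooth (beta nu) (v nu))
    (hmu : mu nu @[nu --> 0^'+] --> (0 : R))
    (happrox : approximates f S w alpha v beta mu)
    (hbdry : \forall nu \near 0^'+, v nu 0 - w 0 = 0 /\ v nu 1 - w 1 = 0)
    (hz : adjoint_solution f S p alpha w z) :
  (fun nu => functionalJ f p z alpha (v nu) (beta nu)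
             - functionalJ f p z alpha w alpha : R^o)
  = (fun nu => (\int[lebesgue_measure]_(x in `[0, 1])
                  dotp (z x) (residual f S (v nu) x))
               + (beta nu - alpha) *
                   (- dotp (z alpha) (jump ((f \o w)^`()) alpha)
                    - jump (p \o w : R -> R^o) alpha) : R^o)
    +o_ (0^'+) (id : R -> R^o).
Proof.
have [al01 _ [h1 [C2h1 wh1]] [h2 [C2h2 wh2]]] := hw.
have /andP[al0 al1] := al01.
have Ch1 := classCW C2h1; have Ch2 := classCW C2h2.
have ch1 := classC_continuous Ch1; have ch2 := classC_continuous Ch2.
have Cf := hf 1%N; have CS := hS 1%N; have Cp := classCW hp.
have [res RHw] := hsol.
have [Z [q [L [Zz ZL [mq qL] dZ adj]]]] := adjoint_extension hz.
have wh1c x : 0 <= x < alpha -> w x = h1 x.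
  by move=> x0a; apply: wh1; rewrite /= in_itv.
have wh2c x : alpha < x <= 1 -> w x = h2 x.
  by move=> xa1; apply: wh2; rewrite /= in_itv.
have wh1o x : 0 < x < alpha -> w x = h1 x.
  by move=> /andP[x0 xa]; apply: wh1c; rewrite ltW.
have wh2o x : alpha < x < 1 -> w x = h2 x.
  by move=> /andP[xa x1]; apply: wh2c; rewrite xa ltW.
have [K K0 close] := approximates_close Ch1 Ch2 wh1c wh2c happrox.
have r1w x : 0 < x < alpha -> residual f S w x = 0.
  by move=> /andP[x0 xa]; apply: res; rewrite ?lt_eqF// x0 (lt_trans xa).
have r2w x : alpha < x < 1 -> residual f S w x = 0.
  by move=> /andP[xa x1]; apply: res; rewrite ?gt_eqF// x1 (lt_trans al0).
have r1 x : 0 < x < alpha -> residual f S h1 x = 0.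
  by move=> x0a; rewrite -(eq_oo_residual _ _ wh1o x0a) r1w.
have r2 x : alpha < x < 1 -> residual f S h2 x = 0.
  by move=> xa1; rewrite -(eq_oo_residual _ _ wh2o xa1) r2w.
have comp1 (W : normedModType R) (F : 'rV[R]_d -> W) x :
    0 < x < alpha -> (F \o w) x = (F \o h1) x by move=> /wh1o /= ->.
have comp2 (W : normedModType R) (F : 'rV[R]_d -> W) x :
    alpha < x < 1 -> (F \o w) x = (F \o h2) x by move=> /wh2o /= ->.
have jumpw (W : normedModType R) (F : 'rV[R]_d -> W) : classC 1 F ->
    jump (F \o w) alpha = F (h2 alpha) - F (h1 alpha).
  move=> CF; apply: (jumpE al01 _ _ (comp1 W F) (comp2 W F)).
    exact: (classC_continuous (classC1_comp CF Ch1)).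
  exact: (classC_continuous (classC1_comp CF Ch2)).
have RH : f (h1 alpha) = f (h2 alpha).
  by move: RHw; rewrite jumpw// => /eqP; rewrite subr_eq0 => /eqP.
(* The equation turns the derivative of [f \o w] into [- S] along each branch, whose one-sided
   limits are values of continuous functions. *)
have jumpf' : jump ((f \o w)^`()) alpha = S (h1 alpha) - S (h2 alpha).
  have -> : S (h1 alpha) - S (h2 alpha) = - S (h2 alpha) - - S (h1 alpha).
    by rewrite opprK addrC.
  apply: (@jumpE _ _ _ (fun x => - S (h1 x)) (fun x => - S (h2 x)) 0 alpha 1 al01).
  - by apply: cvgN; exact: (classC_continuous (classC1_comp CS Ch1)).
  - by apply: cvgN; exact: (classC_continuous (classC1_comp CS Ch2)).
  - move=> x x0a; apply/eqP; rewrite -addr_eq0 -(wh1o _ x0a); apply/eqP.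
    exact: r1w.
  - move=> x x0a; apply/eqP; rewrite -addr_eq0 -(wh2o _ x0a); apply/eqP.
    exact: r2w.
have [L1 L10 h1L] := classC1_lipschitz 0 1 Ch1.
have [L2 L20 h2L] := classC1_lipschitz 0 1 Ch2.
have L0 : 0 <= L by rewrite (le_trans _ (qL 0)).
have [MZ MZ0 ZM'] := continuous_segment_bounded 0 1 (lipschitz_continuous ZL).
(* One constant dominates both [Z] on [[0, 1]] and [q]. *)
pose M := MZ + L.
have ZM x : 0 <= x <= 1 -> `|Z x| <= M.
  by move=> /ZM'/le_trans; apply; rewrite lerDl.
have LM : L <= M by rewrite lerDr.
pose N := `|S (h1 alpha) - S (h2 alpha)|.
pose C := 2 * (1 + 2 * (d%:R * M)) + (2 + d%:R * (4 * M + N)) + 2 * (d%:R * L).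
have C0 : 0 <= C.
  have M0 : 0 <= M by rewrite addr_ge0.
  have N0 : 0 <= N by exact: normr_ge0.
  by rewrite /C !(addr_ge0, mulr_ge0).
have al01' : 0 <= alpha <= 1 by rewrite !ltW.
apply/eqaddoP => eps eps0.
(* The final bound is [e * (K * nu) * C], hence at most [eps * nu]; the added 1 allows [K * C = 0].
   Neither [K] nor [C] depends on [eps] or [nu]. *)
pose e := eps / (K * C + 1).
have KC1 : 0 < K * C + 1 by rewrite ltr_wpDl// mulr_ge0.
have e0 : 0 < e by rewrite divr_gt0.
(* The radius [dl] is fixed by [e] and the branches of [w] before [nu] is chosen, so that [K * nu]
   can then be made small against it. *)
have /filter_ex[dl [dl0 [[f1 f2] [[S1 S2] [p1 p2]]]]] : \forall dl \near 0^'+, 0 < dl /\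
    ((taylor_near_curve dl e f h1 /\ taylor_near_curve dl e f h2) /\
     ((taylor_near_curve dl e S h1 /\ taylor_near_curve dl e S h2) /\
      (taylor_near_curve dl e (p : _ -> R^o) h1 /\
       taylor_near_curve dl e (p : _ -> R^o) h2))).
  do ![apply: filterI]; try exact: classC1_near_curve;
    try exact: classC1_near_curve_scalar.
  exact: nbhs_right_gt.
near=> nu.
have nu0 : 0 < nu by near: nu; exact: nbhs_right_gt.
have [be01 bak cv1 cv2] : [/\ 0 < beta nu < 1, `|beta nu - alpha| <= K * nu,
    forall x, 0 <= x < beta nu -> `|v nu x - h1 x| <= K * nu &
    forall x, beta nu < x <= 1 -> `|v nu x - h2 x| <= K * nu] by near: nu.
have /andP[be0 be1] := be01.
have [_ _ [a [C2a va]] [b [C2b vb]]] : piecewise_smooth (beta nu) (v nu) by near: nu.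
have Ca := classCW C2a; have Cb := classCW C2b.
have ca := classC_continuous Ca; have cb := classC_continuous Cb.
have vac x : 0 <= x < beta nu -> v nu x = a x.
  by move=> x0b; apply: va; rewrite /= in_itv.
have vbc x : beta nu < x <= 1 -> v nu x = b x.
  by move=> xb1; apply: vb; rewrite /= in_itv.
have vao x : 0 < x < beta nu -> v nu x = a x.
  by move=> /andP[x0 xb]; apply: vac; rewrite ltW.
have vbo x : beta nu < x < 1 -> v nu x = b x.
  by move=> /andP[xb x1]; apply: vbc; rewrite xb ltW.
have [bd0 bd1] : v nu 0 - w 0 = 0 /\ v nu 1 - w 1 = 0 by near: nu.
have ab0 : a 0 = h1 0.
  by rewrite -vac ?lexx ?be0// -wh1c ?lexx ?al0//; apply/eqP; rewrite -subr_eq0 bd0.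
have ab1 : b 1 = h2 1.
  by rewrite -vbc ?lexx ?be1// -wh2c ?lexx ?al1//; apply/eqP; rewrite -subr_eq0 bd1.
have cah (h g : R -> 'rV[R]_d) : continuous h -> continuous g ->
    continuous (fun x => g x - h x).
  by move=> ch cg x; apply: cvgB; [exact: cg|exact: ch].
have close1 x : 0 <= x <= beta nu -> `|a x - h1 x| <= K * nu.
  move=> /andP[x0]; rewrite le_eqVlt => /predU1P[->|xb]; last first.
    by rewrite -vac ?x0//; apply: cv1; rewrite x0.
  apply: (norm_le_left_end be0 (cah _ _ ch1 ca (beta nu))) => t /andP[t0 tb].
  by rewrite -vac ?tb ?(ltW t0)//; apply: cv1; rewrite tb ltW.
have close2 x : beta nu <= x <= 1 -> `|b x - h2 x| <= K * nu.
  move=> /andP[+ x1]; rewrite le_eqVlt => /predU1P[<-|xb]; last first.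
    by rewrite -vbc ?xb//; apply: cv2; rewrite xb.
  apply: (norm_le_right_end be1 (cah _ _ ch2 cb (beta nu))) => t /andP[tb t1].
  by rewrite -vbc ?tb ?(ltW t1)//; apply: cv2; rewrite tb ltW.
have small : K * nu + (L1 + L2) * (K * nu) < dl.
  rewrite mulrA -mulrDl; near: nu; apply: near_right_mulr_lt => //.
  by rewrite addr_ge0// mulr_ge0// addr_ge0.
have small' : L * (K * nu) <= e.
  by rewrite mulrA ltW//; near: nu; apply: near_right_mulr_lt => //; exact: mulr_ge0.
have jumpv : jump (f \o v nu) (beta nu) = f (b (beta nu)) - f (a (beta nu)).
  apply: (@jumpE _ _ _ (f \o a) (f \o b) 0 _ 1 be01).
  - exact: (classC_continuous (classC1_comp Cf Ca)).
  - exact: (classC_continuous (classC1_comp Cf Cb)).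
  - by move=> x /vao /= ->.
  - by move=> x /vbo /= ->.
have est := adjoint_error_estimate Cf CS Cp ZL mq qL dZ al01 Ch1 Ch2 wh1o wh2o
  r1 r2 RH adj ZM LM (lexx N) L10 L20 h1L h2L be01 Ca Cb vao vbo ab0 ab1 e0
  f1 f2 S1 S2 p1 p2 small small' bak close1 close2.
have alg (pv pw r jv c k : R) : (pv - jv - (pw - 0)) - (r + c * k) =
  pv - pw - r - jv - c * k by ring.
have zZ : \int[lebesgue_measure]_(x in `[0, 1]) dotp (z x) (residual f S (v nu) x) =
    \int[lebesgue_measure]_(x in `[0, 1]) dotp (Z x) (residual f S (v nu) x).
  by apply: eq_Rintegral => x; rewrite inE/= in_itv/= => /Zz ->.
have cE : - dotp (Z alpha) (S (h1 alpha) - S (h2 alpha)) - (p (h2 alpha) - p (h1 alpha))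
    = p (h1 alpha) - p (h2 alpha) - dotp (Z alpha) (S (h1 alpha) - S (h2 alpha)).
  by rewrite opprB addrC.
have -> : forall g h : R -> R^o, (g - h) nu = g nu - h nu by [].
rewrite /functionalJ zZ jumpv RHw dotp0 jumpf' (jumpw R^o p Cp) -(Zz _ al01') cE alg.
apply: (le_trans est).
have algC : e * (K * nu) * C = e * (K * C) * nu by ring.
rewrite -/C [`|id nu|](gtr0_norm nu0) algC ler_wpM2r ?(ltW nu0)//.
by rewrite /e mulrAC ler_pdivrMr// ler_wpM2l ?(ltW eps0)// lerDl.
Unshelve. all: by end_near. Qed.
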